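(* Consider the $N$-period economic dispatch problem with storage described in the context. For each vector of storage capacities $b \in \mathbb{R}_+^m$, there exists an optimal control policy $\pi^* \in \Pi(b)$, i.e. an admissible policy with $J^{\pi^*}(b) = J^*(b)$. Furthermore, $J^*(b)$ is convex and non-increasing in $b$ (on $\mathbb{R}_+^m$).
   Context: Network. A power network is a connected undirected graph on $m$ nodes $1,\dots,m$ with $\ell$ edges (transmission lines). The line joining $i$ and $j$ has susceptance $y^{ij}=y^{ji}$ (with $y^{ij}=0$ if $i\ne j$ are not joined by a line), and $y^{ii}$ is the susceptance of the shunt element at node $i$. Let $Y \in \mathbb{R}^{m\times m}$ with $Y^{ij}=-y^{ij}$ for $i\ne j$ and $Y^{ii}=y^{ii}+\sum_{j\neq i} y^{ij}$. Let $B\in\mathbb{R}^{\ell\times m}$ be the weighted incidence matrix: for line $k$ joining $i$ and $j$, $B^{ki}=-B^{kj}=y^{ij}$ and $B^{kr}=0$ for $r\ne i,j$. Let $f\in\mathbb{R}_+^\ell$ be the vector of line capacities. The injection polytope is $\mathcal{P}=\{x\in\mathbb{R}^m : x=Y\theta,\ -f\le B\theta\le f \text{ for some }\theta\in\mathbb{R}^m\}$. Costs. For $x\in\mathbb{R}$, $x^+=\max\{x,0\}$. For constants $\alpha^i\ge\beta^i\ge 0$, let $g^i(v^i)=\alpha^i (v^i)^+-\beta^i(-v^i)^+$ and $g(v)=\sum_{i=1}^m g^i(v^i)$ for $v\in\mathbb{R}^m$. Net demand. $\{\xi_0,\dots,\xi_{N-1}\}$ is a random process with known joint distribution, each $\xi_k$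 taking values in $\Xi\subset\mathbb{R}^m$ (no stationarity or independence across time or space is assumed). Storage. For $b\in\mathbb{R}_+^m$ let $\mathcal{Z}(b)=\{z\in\mathbb{R}^m_+ : 0\le z\le b\}$ (componentwise). Storage states evolve as $z_{k+1}=z_k+u_k$, $k=0,\dots,N-1$, with $z_0=0$. Policies. At time $k$ the available information is $I_k=(z_{\le k},\xi_{\le k})$, where $x_{\le k}=(x_0,\dots,x_k)$. A control policy $\pi=((\mu_0,\nu_0),\dots,(\mu_{N-1},\nu_{N-1}))$ maps the available information to inputs $u_k=\mu_k(I_k)\in\mathbb{R}^m$ and $v_k=\nu_k(I_k)\in\mathbb{R}^m$ for each $k=0,\dots,N-1$. It is admissible if $z_k+\mu_k(I_k)\in\mathcal{Z}(b)$ and $\nu_k(I_k)-\mu_k(I_k)-\xi_k\in\mathcal{P}$ almost surely for each $k=0,\dots,N-1$; $\Pi(b)$ denotes the set of all admissible policies. The expected cost is $J^\pi(b)=\mathbb{E}\big[\sum_{k=0}^{N-1} g(\nu_k(I_k))\big]$, and $J^*(b)=\inf\{J^\pi(b):\pi\in\Pi(b)\}$. A policy $\pi^*\in\Pi(b)$ is optimal if $J^{\pi^*}(b)=J^*(b)$.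
   Formalization: Existence of an optimal policy is stated under the added assumption that the cost g is bounded below on the injection polytope (automatic if it is bounded); with nonzero shunts it may be unbounded, and then J* can be minus infinity without being attained. *)

(* Defs.v *)
From HB Require Import structures.
From mathcomp Require Import all_boot all_order all_algebra.
From mathcomp Require Import all_classical all_reals all_analysis.

Set Implicit Arguments.
Unset Strict Implicit.
Unset Printing Implicit Defensive.

Import Order.TTheory GRing.Theory Num.Theory.
Import numFieldNormedType.Exports.

Local Open Scope classical_set_scope.
Local Open Scope ring_scope.

(* Real matrices, hence column vectors, carry the sigma-algebra generated by
   the entries, i.e. the Borel sigma-algebra of R^(m x n).  Tuples and pairs of
   them get the product sigma-algebras already present in the library. *)

Definition measure_matrix_display : measure_display.
Proof. exact: default_measure_display. Qed.

Section measurable_matrix.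
Variables (R : realType) (m n : nat).

Definition mx_measurable : set (set 'M[R]_(m, n)) :=
  <<s \bigcup_(ij in [set: 'I_m * 'I_n])
        preimage_set_system setT (fun A : 'M[R]_(m, n) => A ij.1 ij.2)
          measurable >>.

Let mx_measurable0 : mx_measurable set0.
Proof. exact: sigma_algebra0. Qed.

Let mx_measurableC A : mx_measurable A -> mx_measurable (~` A).
Proof. by move=> mA; rewrite -setTD; exact: sigma_algebraCD. Qed.

Let mx_measurable_bigcup (F : (set 'M[R]_(m, n))^nat) :
  (forall i, mx_measurable (F i)) -> mx_measurable (\bigcup_i (F i)).
Proof. by move=> mF; exact: sigma_algebra_bigcup. Qed.

HB.instance Definition _ :=
  @isMeasurable.Build measure_matrix_display 'M[R]_(m, n) mx_measurable
    mx_measurable0 mx_measurableC mx_measurable_bigcup.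

End measurable_matrix.

Section network.
Variable R : realType.

(* Each line carries an arbitrary orientation [lsrc k -> ldst k]; it only fixes
   the sign of a row of the incidence matrix, and the capacity constraint is
   symmetric.  Off-diagonal entries of [susc] are line susceptances and
   diagonal entries are shunt susceptances.  Their signs are unrestricted. *)
Record network (m l : nat) := Network {
  lsrc : 'I_l -> 'I_m;
  ldst : 'I_l -> 'I_m;
  susc : 'M[R]_m;
  cap : 'cV[R]_l;
  line_loopless : forall k, lsrc k != ldst k;
  line_simple : forall k k',
    [set lsrc k; ldst k]%SET = [set lsrc k'; ldst k']%SET -> k = k';
  line_connected : forall i j,
    connect (fun i j => [exists k, [set lsrc k; ldst k]%SET == [set i; j]%SET])
      i j;
  susc_sym : forall i j, susc i j = susc j i;
  susc_noline : forall i j, i != j ->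
    (forall k, [set lsrc k; ldst k]%SET != [set i; j]%SET) -> susc i j = 0;
  cap_ge0 : forall k, 0 <= cap k 0
}.

Variables (m l : nat) (G : network m l).

Definition admittance : 'M[R]_m :=
  \matrix_(i, j) if i == j then susc G i i + \sum_(r | r != i) susc G i r
                 else - susc G i j.

Definition incidence : 'M[R]_(l, m) :=
  \matrix_(k, r) if r == lsrc G k then susc G (lsrc G k) (ldst G k)
                 else if r == ldst G k then - susc G (lsrc G k) (ldst G k)
                 else 0.

Definition injection_polytope : set 'cV[R]_m :=
  [set x | exists theta : 'cV[R]_m, x = admittance *m theta /\
     forall k, - cap G k 0 <= (incidence *m theta) k 0 <= cap G k 0].

End network.

Definition gen_cost (R : realType) (m : nat) (alpha beta v : 'cV[R]_m) : R :=
  \sum_i (alpha i 0 * Num.max (v i 0) 0 - beta i 0 * Num.max (- v i 0) 0).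

Definition storage_set (R : realType) (m : nat) (b : 'cV[R]_m) :
    set 'cV[R]_m :=
  [set z | forall i, 0 <= z i 0 <= b i 0].

(* The information (z_0, .., z_k), (xi_0, .., xi_k) available at time k. *)
Definition info (R : realType) (m k : nat) : Type :=
  ((k.+1).-tuple 'cV[R]_m * (k.+1).-tuple 'cV[R]_m)%type.

(* A policy is given at every time k : nat; an N-period problem only looks at
   its components k < N. *)
Record policy (R : realType) (m : nat) := Policy {
  pol_mu : forall k, info R m k -> 'cV[R]_m;
  pol_nu : forall k, info R m k -> 'cV[R]_m;
  pol_mu_measurable : forall k,
    measurable_fun [set: info R m k] (@pol_mu k);
  pol_nu_measurable : forall k,
    measurable_fun [set: info R m k] (@pol_nu k)
}.

Section closed_loop.
Variables (R : realType) (m : nat) (pi : policy R m).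
(* a realization of the net demand process *)
Variable x : nat -> 'cV[R]_m.

Definition demand_upto (k : nat) : (k.+1).-tuple 'cV[R]_m :=
  [tuple x i | i < k.+1].

Fixpoint storage_upto (k : nat) : (k.+1).-tuple 'cV[R]_m :=
  match k with
  | 0 => [tuple 0]
  | k'.+1 =>
    let zs := storage_upto k' in
    [tuple of rcons zs
       (tnth zs ord_max + @pol_mu _ _ pi k' (zs, demand_upto k'))]
  end.

Definition info_at (k : nat) : info R m k := (storage_upto k, demand_upto k).

Definition storage_at (k : nat) : 'cV[R]_m := tnth (storage_upto k) ord_max.

Definition storage_input (k : nat) : 'cV[R]_m := pol_mu pi (info_at k).

Definition gen_input (k : nat) : 'cV[R]_m := pol_nu pi (info_at k).

End closed_loop.

Section dispatch.
Variables (R : realType) (d : measure_display) (T : measurableType d).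
Variable P : probability T R.
Variables (m l : nat) (G : network R m l) (alpha beta : 'cV[R]_m).
Variables (N : nat) (xi : nat -> T -> 'cV[R]_m).

Definition admissible (b : 'cV[R]_m) : set (policy R m) :=
  [set pi | forall k, (k < N)%N ->
     {ae P, forall t, storage_set b
        (storage_at pi (xi ^~ t) k + storage_input pi (xi ^~ t) k)} /\
     {ae P, forall t, injection_polytope G
        (gen_input pi (xi ^~ t) k - storage_input pi (xi ^~ t) k - xi k t)}].

(* Extended-real valued: no integrability is required of the demand.  The
   expectation of a function whose positive and negative parts both have
   infinite integral is -oo, by the library's convention. *)
Definition expected_cost (pi : policy R m) : \bar R :=
  'E_P[(fun t => \sum_(k < N)
     gen_cost alpha beta (gen_input pi (xi ^~ t) k))%R]%E.

Definition optimal_cost (b : 'cV[R]_m) : \bar R :=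
  ereal_inf [set expected_cost pi | pi in admissible b].

End dispatch.

(* Main.v *)
(** A policy is, along the closed loop, a pair of functions of the observed
    demands: the storage levels z_{k+1} and the generation v_k.  Averaging two
    such pairs gives convexity.  The costs for two capacities differ by at most
    a constant (the storage can be left empty), so infinite values do not
    interfere.

    For existence, the generation is optimized first: h(w) = min g(w + p) over
    p in P is attained by a Borel selection, obtained by Fourier-Motzkin
    elimination, and h is convex and Lipschitz.  It remains to minimize the
    convex functional E[sum_k h(xi_k + z_{k+1} - z_k)] over adapted processes
    with 0 <= z <= b.  A minimizing sequence of nearly minimal L^2 norm is
    Cauchy in L^2; along a fast enough one the processes converge almost
    surely, and dominated convergence shows that the limit is optimal. *)

Require Import Defs.
From HB Require Import structures.
From mathcomp Require Import all_boot all_order all_algebra.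
From mathcomp Require Import all_classical all_reals all_analysis.
From mathcomp Require Import measurable_realfun lra ring.

Import Order.TTheory GRing.Theory Num.Theory.
Import numFieldNormedType.Exports.

Local Open Scope classical_set_scope.
Local Open Scope ring_scope.

(** * Fourier-Motzkin elimination with measurable selection *)

Lemma measurable_bigmax d (W : measurableType d) (R : realType) (J : Type)
    (s : seq J) (p : pred J) (f : W -> R) (F : J -> W -> R) :
  measurable_fun setT f -> (forall j, measurable_fun setT (F j)) ->
  measurable_fun setT (fun w => \big[Num.max/f w]_(j <- s | p j) F j w).
Proof.
move=> mf mF; elim: s => [|j s ih].
  by rewrite (_ : (fun w => _) = f)//; apply/funext => w; rewrite big_nil.
under eq_fun do rewrite big_cons.
by case: (p j) => //; exact: measurable_maxr.
Qed.

Lemma measurable_bigmin d (W : measurableType d) (R : realType) (J : Type)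
    (s : seq J) (p : pred J) (f : W -> R) (F : J -> W -> R) :
  measurable_fun setT f -> (forall j, measurable_fun setT (F j)) ->
  measurable_fun setT (fun w => \big[Num.min/f w]_(j <- s | p j) F j w).
Proof.
move=> mf mF; elim: s => [|j s ih].
  by rewrite (_ : (fun w => _) = f)//; apply/funext => w; rewrite big_nil.
under eq_fun do rewrite big_cons.
by case: (p j) => //; exact: measurable_minr.
Qed.

(* Back substitution assigns to each variable the largest of its lower bounds;
   that this is a formula in the parameters makes the selection measurable. *)
Lemma fourier_motzkin d (W : measurableType d) (R : realType)
    (Q : (W -> R) -> Prop) (Q0 : Q (fun=> 0))
    (QD : forall a a', Q a -> Q a' -> Q (fun w => a w + a' w))
    (QM : forall x a, Q a -> Q (fun w => x * a w))
    (Qm : forall a, Q a -> measurable_fun setT a)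
    (n : nat) (J : finType) (a : J -> W -> R) (c : J -> 'I_n -> R) :
  (forall j, Q (a j)) ->
  exists (J' : finType) (a' : J' -> W -> R) (s : 'I_n -> W -> R),
    [/\ forall j, Q (a' j), forall i, measurable_fun setT (s i),
     (forall w (x : 'I_n -> R), (forall j, a j w + \sum_i c j i * x i <= 0) ->
        forall j, a' j w <= 0)
   & forall w, (forall j, a' j w <= 0) ->
       forall j, a j w + \sum_i c j i * s i w <= 0].
Proof.
elim: n => [|n IH] in J a c * => Qa.
  exists J, a, (fun _ _ => 0); split => //.
  - by move=> w x h j; have := h j; rewrite big_ord0 addr0.
  - by move=> w h j; rewrite big_ord0 addr0.
pose cond (p : J * J) := (0 < c p.1 ord0) && (c p.2 ord0 < 0).
pose J1 : finType := (J * J)%type.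
(* Two rows whose first coefficients have opposite signs are scaled and added so that the first
   variable cancels. A row [p.1] free of that variable is kept; every other pair yields the trivial
   row [0 <= 0]. *)
pose a1 (p : J1) w := if cond p then
    (c p.1 ord0)^-1 * a p.1 w + (- c p.2 ord0)^-1 * a p.2 w
  else if c p.1 ord0 == 0 then a p.1 w else 0.
pose c1 (p : J1) i := if cond p then
    (c p.1 ord0)^-1 * c p.1 (lift ord0 i)
      + (- c p.2 ord0)^-1 * c p.2 (lift ord0 i)
  else if c p.1 ord0 == 0 then c p.1 (lift ord0 i) else 0.
have Qa1 p : Q (a1 p).
  by rewrite /a1; case: (cond p) => //; [apply: QD; apply: QM|case: eqP].
have [J' [a' [s [Qa' ms fwd bwd]]]] := IH J1 a1 c1 Qa1.
pose r j w := a j w + \sum_i c j (lift ord0 i) * s i w.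
have mr j : measurable_fun setT (r j).
  apply: measurable_funD; first exact: Qm.
  by apply: measurable_sum => i; apply: measurable_funM.
pose bnd j w := - (c j ord0)^-1 * r j w.
have mbnd j : measurable_fun setT (bnd j) by apply: measurable_funM.
(* The default of the outer maximum is the minimum of [0] and all upper bounds. It violates no upper
   bound, so it does no harm beside the lower bounds and serves when there are none. *)
pose y w := \big[Num.max/ \big[Num.min/0]_(j | 0 < c j ord0) bnd j w]_
  (j | c j ord0 < 0) bnd j w.
have my : measurable_fun setT y.
  by apply: measurable_bigmax => //; exact: measurable_bigmin.
have sumE (p : J1) w (x : 'I_n -> R) :
    a1 p w + \sum_i c1 p i * x i =
    if cond p then
      (c p.1 ord0)^-1 * (a p.1 w + \sum_i c p.1 (lift ord0 i) * x i)
      + (- c p.2 ord0)^-1 * (a p.2 w + \sum_i c p.2 (lift ord0 i) * x i)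
    else if c p.1 ord0 == 0 then a p.1 w + \sum_i c p.1 (lift ord0 i) * x i
    else 0.
  rewrite /a1 /c1; case: (cond p); last first.
    case: eqP => // _.
    by rewrite big1 ?addr0// => i _; rewrite mul0r.
  rewrite !mulrDr addrACA; congr (_ + _).
  rewrite !mulr_sumr -big_split; apply: eq_bigr => i _ /=.
  by rewrite mulrDl !mulrA.
exists J', a', (fun i => if unlift ord0 i is Some i' then s i' else y).
split => //.
- by move=> i; case: unliftP.
- move=> w x h j; apply: (fwd w (x \o lift ord0)) => p; rewrite sumE.
  have := h p.1; have := h p.2; rewrite !big_ord_recl /=.
  set r1 := \sum_i _; set r2 := \sum_i _ => h2 h1.
  rewrite /cond; case: ifPn => [/andP[p1 p2]|_]; last first.
    by case: eqP h1 => // ->; rewrite mul0r add0r.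
  have {}h1 : (c p.1 ord0)^-1 * (a p.1 w + r2) <= - x ord0.
    by rewrite mulrC ler_pdivrMr//; nra.
  have {}h2 : (- c p.2 ord0)^-1 * (a p.2 w + r1) <= x ord0.
    by rewrite mulrC ler_pdivrMr ?oppr_gt0//; nra.
  lra.
- move=> w h j; rewrite big_ord_recl unlift_none.
  under eq_bigr do rewrite liftK.
  have := bwd w h; move=> {}h.
  have hr : a j w + (c j ord0 * y w + \sum_i c j (lift ord0 i) * s i w)
    = c j ord0 * y w + r j w by rewrite /r; ring.
  rewrite hr; case: (ltgtP (c j ord0) 0) => [cj|cj|cj].
  + have : bnd j w <= y w by exact: le_bigmax_cond.
    rewrite /bnd mulNr -mulrN mulrC ler_ndivrMr//; nra.
  + have : y w <= bnd j w.
      apply: bigmax_le; first exact: bigmin_le_cond.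
      move=> q cq; have := h (j, q); rewrite sumE /cond /= cj cq /=.
      rewrite -!/(r _ _) /bnd invrN; lra.
    rewrite /bnd mulNr -mulrN mulrC ler_pdivlMr//; nra.
  + have := h (j, j); rewrite sumE /cond /= cj ltxx/= eqxx mul0r add0r; exact.
Qed.

(** Only [x] is eliminated, with the pair [(w, t)] as parameter. The remaining rows are affine in
    [t], and the least feasible [t] is the largest of the lower bounds they impose, a measurable
    formula in [w]. *)
Lemma parametric_linear_min d (W : measurableType d) (R : realType) (w0 : W)
    (n : nat) (J : finType) (a : J -> W -> R) (e : J -> R) (c : J -> 'I_n -> R)
    (feas := fun w t (x : 'I_n -> R) =>
       forall j, a j w + e j * t + \sum_i c j i * x i <= 0) :
  (forall j, measurable_fun setT (a j)) ->
  (forall w, exists t x, feas w t x) ->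
  (forall w, exists C, forall t x, feas w t x -> C <= t) ->
  exists (h : W -> R) (s : 'I_n -> W -> R),
    [/\ measurable_fun setT h, forall i, measurable_fun setT (s i),
     forall w, feas w (h w) (s ^~ w)
   & forall w t x, feas w t x -> h w <= t].
Proof.
move=> ma nonempty bounded.
(* Linear combinations of rows stay in this class: the coefficient of [t] remains a constant, so its
   sign does not depend on [w]. *)
pose Q (q : W * R -> R) := exists (q0 : W -> R) (k : R),
  measurable_fun setT q0 /\ q = (fun p => q0 p.1 + k * p.2).
have Qa j : Q (fun p : W * R => a j p.1 + e j * p.2) by exists (a j), (e j).
have Q0 : Q (fun=> 0).
  by exists (fun=> 0), 0; split => //; apply/funext => p; rewrite mul0r addr0.
have QD q q' : Q q -> Q q' -> Q (fun p => q p + q' p).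
  move=> [q0 [k [mq ->]]] [q0' [k' [mq' ->]]].
  exists (fun w => q0 w + q0' w), (k + k').
  by split; [exact: measurable_funD|apply/funext => p; ring].
have QM x q : Q q -> Q (fun p => x * q p).
  move=> [q0 [k [mq ->]]]; exists (fun w => x * q0 w), (x * k).
  by split; [exact: measurable_funM|apply/funext => p; ring].
have Qm q : Q q -> measurable_fun setT q.
  move=> [q0 [k [mq ->]]]; apply: measurable_funD.
    exact: measurableT_comp.
  exact: measurable_funM.
have [J' [a' [s [Qa' ms fwd bwd]]]] :=
  fourier_motzkin _ _ _ Q Q0 QD QM Qm _ _ _ c Qa.
have {Qa'} /choice[q Qq] := Qa'.
have {Qq} /choice[k Qk] := Qq.
have mq j : measurable_fun setT (q j) by have [] := Qk j.
have a'E j w t : a' j (w, t) = q j w + k j * t by have [_ ->] := Qk j.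
have lb w t x : feas w t x -> forall j, k j < 0 -> - (k j)^-1 * q j w <= t.
  move=> wtx j kj; have := fwd (w, t) x wtx j; rewrite a'E => ?.
  by rewrite mulNr -mulrN mulrC ler_ndivrMr//; nra.
(* Were no coefficient negative, a feasible [t] at [w0] could be lowered below its bound [C]. The
   row [j0] also supplies the default of the maximum defining [h]. *)
have [j0 kj0] : exists j, k j < 0.
  apply: contrapT => /forallNP kge0.
  have [t [x wtx]] := nonempty w0; have [C Cmin] := bounded w0.
  pose t' := Num.min t (C - 1).
  have : feas w0 t' (s ^~ (w0, t')).
    move=> j; apply: (bwd (w0, t')) => {}j; rewrite a'E.
    have := fwd (w0, t) x wtx j; rewrite a'E.
    have : 0 <= k j by rewrite leNgt; apply/negP/kge0.
    have : t' <= t by rewrite ge_min lexx.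
    by nra.
  move/Cmin; rewrite /t' => Ct.
  have : t' <= C - 1 by rewrite ge_min lexx orbT.
  by rewrite /t'; lra.
pose bnd j w := - (k j)^-1 * q j w.
have mbnd j : measurable_fun setT (bnd j) by apply: measurable_funM.
pose h w := \big[Num.max/bnd j0 w]_(j | k j < 0) bnd j w.
have mh : measurable_fun setT h by exact: measurable_bigmax.
have h_lb w t x : feas w t x -> h w <= t.
  by move=> wtx; apply: bigmax_le => [|j]; exact: (lb _ _ _ wtx).
exists h, (fun i w => s i (w, h w)); split => //.
  move=> i; apply: measurableT_comp => //.
  exact: measurable_fun_pair.
move=> w j; apply: (bwd (w, h w)) => {}j; rewrite a'E.
have [t [x wtx]] := nonempty w.
have := fwd (w, t) x wtx j; rewrite a'E => tj.
have ht := h_lb _ _ _ wtx.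
(* A row with [0 <= k j] holds at some feasible [t >= h w], hence at [h w]; a row with [k j < 0] is
   one of the bounds entering the maximum. *)
case: (ltP (k j) 0) => kj; last by nra.
have : bnd j w <= h w by exact: le_bigmax_cond.
by rewrite /bnd mulNr -mulrN mulrC ler_ndivrMr//; nra.
Qed.

(** * Measurability of matrix-valued functions *)

Lemma measurable_entry (R : realType) (m n : nat) (i : 'I_m) (j : 'I_n) :
  measurable_fun setT (fun A : 'M[R]_(m, n) => A i j).
Proof.
move=> _ B mB; rewrite setTI; apply: sub_sigma_algebra.
by exists (i, j) => //; exists B; rewrite // setTI.
Qed.

Lemma measurable_matrix d (S : measurableType d) (R : realType) (m n : nat)
    (f : S -> 'M[R]_(m, n)) :
  (forall i j, measurable_fun setT (fun x => f x i j)) ->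
  measurable_fun setT f.
Proof.
move=> mf.
apply: (@measurability _ _ S 'M[R]_(m, n) setT f
  (\bigcup_(ij in [set: 'I_m * 'I_n])
        preimage_set_system setT (fun A : 'M[R]_(m, n) => A ij.1 ij.2)
          measurable)) => //.
move=> _ [_ [ij _ [B mB <-]] <-].
rewrite setTI; have := mf ij.1 ij.2 measurableT B mB.
by rewrite !setTI.
Qed.

Lemma measurable_matrix_entry d (S : measurableType d) (R : realType)
    (m n : nat) (f : S -> 'M[R]_(m, n)) i j :
  measurable_fun setT f -> measurable_fun setT (fun x => f x i j).
Proof. by move=> mf; apply: (measurableT_comp (measurable_entry _ _ _ i j)). Qed.

Lemma measurable_matrixD d (S : measurableType d) (R : realType) (m n : nat)
    (f g : S -> 'M[R]_(m, n)) :
  measurable_fun setT f -> measurable_fun setT g ->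
  measurable_fun setT (fun x => f x + g x).
Proof.
move=> mf mg; apply: measurable_matrix => i j.
rewrite (_ : (fun x => _) = (fun x => f x i j + g x i j)); last first.
  by apply/funext => x; rewrite mxE.
by apply: measurable_funD; exact: measurable_matrix_entry.
Qed.

Lemma measurable_matrixZ d (S : measurableType d) (R : realType) (m n : nat)
    (r : R) (f : S -> 'M[R]_(m, n)) :
  measurable_fun setT f -> measurable_fun setT (fun x => r *: f x).
Proof.
move=> mf; apply: measurable_matrix => i j.
rewrite (_ : (fun x => _) = (fun x => r * f x i j)); last first.
  by apply/funext => x; rewrite mxE.
by apply: measurable_funM => //; exact: measurable_matrix_entry.
Qed.

Lemma measurable_matrixB d (S : measurableType d) (R : realType) (m n : nat)
    (f g : S -> 'M[R]_(m, n)) :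
  measurable_fun setT f -> measurable_fun setT g ->
  measurable_fun setT (fun x => f x - g x).
Proof.
move=> mf mg; under eq_fun do rewrite -scaleN1r.
exact/measurable_matrixD/measurable_matrixZ.
Qed.

Lemma measurable_mulmx d (S : measurableType d) (R : realType) (m n p : nat)
    (A : 'M[R]_(m, n)) (f : S -> 'M[R]_(n, p)) :
  measurable_fun setT f -> measurable_fun setT (fun x => A *m f x).
Proof.
move=> mf; apply: measurable_matrix => i j.
rewrite (_ : (fun x => _) = (fun x => \sum_k A i k * f x k j)); last first.
  by apply/funext => x; rewrite mxE.
apply: measurable_sum => k.
by apply: measurable_funM => //; exact: measurable_matrix_entry.
Qed.

(** * Minimal generation cost over the injection polytope *)

Section generation_cost.
Context (R : realType) (m : nat) (alpha beta : 'cV[R]_m).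
Hypothesis cost_coeffs : forall i, 0 <= beta i 0 <= alpha i 0.
Local Notation g := (gen_cost alpha beta).

(** A pattern [chi] picks one of the two linear pieces at every node. Since [beta <= alpha],
    [gen_cost] is the maximum of the resulting [2^m] linear forms, which turns its minimization into
    a linear program. *)
Let slope (chi : {ffun 'I_m -> bool}) i :=
  if chi i then alpha i 0 else beta i 0.

Let max_opp_split (a b v : R) : a * Num.max v 0 - b * Num.max (- v) 0 =
  if 0 <= v then a * v else b * v.
Proof.
case: ifPn => [v0|]; last rewrite -ltNge => v0.
- by rewrite (max_l v0) max_r ?oppr_le0// mulr0 subr0.
- by rewrite (max_r (ltW v0)) max_l ?oppr_ge0 ?ltW// mulr0 sub0r mulrN opprK.
Qed.

Lemma linear_le_gen_cost chi (v : 'cV[R]_m) :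
  \sum_i slope chi i * v i 0 <= g v.
Proof.
apply: ler_sum => i _ /=; have /andP[b0 ba] := cost_coeffs i.
rewrite max_opp_split /slope; case: (chi i); case: (leP 0 (v i 0)) => v0.
all: nra.
Qed.

Lemma gen_cost_linear (v : 'cV[R]_m) :
  exists chi, g v = \sum_i slope chi i * v i 0.
Proof.
exists [ffun i => 0 <= v i 0]; apply: eq_bigr => i _; rewrite /slope ffunE.
by rewrite max_opp_split; case: ifP.
Qed.

(** The linear form attaining the cost at [u + v] is additive and lies below [g] at both [u] and
    [v]. *)
Lemma gen_costD_le (u v : 'cV[R]_m) : g (u + v) <= g u + g v.
Proof.
have [chi ->] := gen_cost_linear (u + v).
apply: le_trans (lerD (linear_le_gen_cost chi u) (linear_le_gen_cost chi v)).
by rewrite -big_split; apply: ler_sum => i _; rewrite mxE mulrDr.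
Qed.

Lemma gen_costZ (t : R) (v : 'cV[R]_m) : 0 <= t -> g (t *: v) = t * g v.
Proof.
move=> t0; rewrite /gen_cost mulr_sumr; apply: eq_bigr => i _.
have maxZ x : Num.max (t * x) 0 = t * Num.max x 0.
  by rewrite maxr_pMr// mulr0.
by rewrite !mxE -(mulrN t (v i 0)) !maxZ; ring.
Qed.

Lemma gen_cost_convex (t : R) (u v : 'cV[R]_m) : 0 <= t <= 1 ->
  g (t *: u + (1 - t) *: v) <= t * g u + (1 - t) * g v.
Proof.
move=> /andP[t0 t1]; apply: le_trans (gen_costD_le _ _) _.
by rewrite !gen_costZ ?subr_ge0.
Qed.

Lemma gen_cost_le_abs (v : 'cV[R]_m) : g v <= \sum_i alpha i 0 * `|v i 0|.
Proof.
apply: ler_sum => i _ /=; have /andP[b0 ba] := cost_coeffs i.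
rewrite max_opp_split; case: (leP 0 (v i 0)) => v0.
- by rewrite ger0_norm.
- by rewrite ltr0_norm//; nra.
Qed.

Lemma measurable_gen_cost : measurable_fun setT g.
Proof.
apply: measurable_sum => i.
apply: measurable_funB; apply: measurable_funM => //; apply: measurable_maxr => //.
  exact: measurable_entry.
by apply: measurableT_comp => //; exact: measurable_entry.
Qed.

Context (l : nat) (G : network R m l).
Local Notation P := (injection_polytope G).

Lemma injection_polytope_convex (t : R) (x y : 'cV[R]_m) : 0 <= t <= 1 ->
  P x -> P y -> P (t *: x + (1 - t) *: y).
Proof.
move=> /andP[t0 t1] [th [-> hth]] [ta [-> hta]].
exists (t *: th + (1 - t) *: ta); split.
  by rewrite mulmxDr -!scalemxAr.
move=> k; rewrite mulmxDr -!scalemxAr.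
have combE (u v : 'cV[R]_l) :
    (t *: u + (1 - t) *: v) k 0 = t * u k 0 + (1 - t) * v k 0 by rewrite !mxE.
rewrite combE.
by have /andP[] := hth k; have /andP[] := hta k; move=> *; apply/andP; split; nra.
Qed.

Lemma dispatch_selection : (exists C : R, forall x, P x -> C <= g x) ->
  exists (h : 'cV[R]_m -> R) (s : 'cV[R]_m -> 'cV[R]_m),
    [/\ measurable_fun setT h, measurable_fun setT s,
     forall w, P (s w) /\ g (w + s w) = h w
   & forall w p, P p -> h w <= g (w + p)].
Proof.
move=> [C PC].
pose Y := admittance G; pose B := incidence G.
(* Two rows per line express the capacity limits, and one row per pattern [chi] puts the
   corresponding linear piece of the cost below [t]. *)
pose J : finType := (('I_l * bool) + {ffun 'I_m -> bool})%type.
pose sg (b : bool) : R := if b then 1 else -1.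
pose a (j : J) (w : 'cV[R]_m) := match j with
  | inl p => - cap G p.1 0 | inr chi => \sum_i slope chi i * w i 0 end.
pose e (j : J) : R := if j is inr _ then -1 else 0.
pose c (j : J) (i : 'I_m) := match j with
  | inl p => sg p.2 * B p.1 i
  | inr chi => \sum_r slope chi r * Y r i end.
have feasP (w : 'cV[R]_m) (t : R) (x : 'I_m -> R) :
    (forall j, a j w + e j * t + \sum_i c j i * x i <= 0) <->
    (forall k, - cap G k 0 <= (B *m \col_i x i) k 0 <= cap G k 0) /\
    g (w + Y *m \col_i x i) <= t.
  have xE i : (\col_i x i) i 0 = x i by rewrite mxE.
  have lineE k b : a (inl (k, b)) w + e (inl (k, b)) * t
      + \sum_i c (inl (k, b)) i * x i
      = - cap G k 0 + sg b * (B *m \col_i x i) k 0.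
    rewrite /= mul0r addr0; congr (_ + _); rewrite mxE mulr_sumr.
    by apply: eq_bigr => i _; rewrite xE mulrA.
  have costE chi : a (inr chi) w + e (inr chi) * t
      + \sum_i c (inr chi) i * x i
      = \sum_i slope chi i * (w + Y *m \col_i x i) i 0 - t.
    rewrite /= mulN1r addrAC; congr (_ - _).
    under [in RHS]eq_bigr do rewrite mxE mulrDr.
    rewrite big_split; congr (_ + _) => /=.
    under eq_bigr do rewrite mulr_suml.
    rewrite exchange_big; apply: eq_bigr => r _ /=.
    by rewrite mxE mulr_sumr; apply: eq_bigr => i _; rewrite xE mulrA.
  split=> [h|[hk hg] [[k b]|chi]].
  - split=> [k|].
      have := h (inl (k, true)); have := h (inl (k, false)).
      by rewrite !lineE /sg => *; apply/andP; split; lra.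
    have [chi ->] := gen_cost_linear (w + Y *m \col_i x i).
    by have := h (inr chi); rewrite costE subr_le0.
  - by rewrite lineE /sg; have /andP[] := hk k; case: b; lra.
  - by rewrite costE subr_le0 (le_trans (linear_le_gen_cost _ _)).
have ma j : measurable_fun setT (a j).
  case: j => [p|chi]; rewrite /a //=; apply: measurable_sum => i; apply: measurable_funM => //.
  exact: measurable_entry.
have colK (x : 'cV[R]_m) : \col_i x i 0 = x.
  by apply/colP => i; rewrite mxE.
have [w||h [s [mh ms hs hmin]]] :=
  parametric_linear_min _ 'cV[R]_m R 0 _ _ a e c ma.
- exists (g w), (fun i => (0 : 'cV[R]_m) i 0); apply/feasP.
  rewrite colK !mulmx0 addr0; split=> // k.
  by rewrite mxE oppr_le0 cap_ge0.
(* By subadditivity [g p <= g (w + p) + g (- w)], so the bound [C] on the polytope carries over to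
   its translate by [w]. *)
- move=> w; exists (C - g (- w)) => t x /feasP[hk]; apply: le_trans.
  rewrite lerBlDr -[X in _ <= g X + _]addrC.
  apply: le_trans (gen_costD_le _ _); rewrite addrK.
  by apply: PC; exists (\col_i x i).
exists h, (fun w => Y *m \col_i s i w); split => //.
- apply: measurable_mulmx; apply: measurable_matrix => i j.
  by rewrite (_ : (fun x => _) = s i)//; apply/funext => w; rewrite mxE.
- move=> w; have /feasP[hk hg] := hs w.
  split; first by exists (\col_i s i w).
  apply/eqP; rewrite eq_le hg /=; apply: (hmin _ _ (s ^~ w)); exact/feasP.
- move=> w _ [th [-> hk]]; apply: (hmin _ _ (fun i => th i 0)).
  by apply/feasP; rewrite colK.
Qed.

End generation_cost.

(** * Policies in open-loop form *)

Section closed_loop_measurability.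
Context d (S : measurableType d) (R : realType) (m : nat).
Variable x : nat -> S -> 'cV[R]_m.

Lemma measurable_rcons_tuple n (f : S -> n.-tuple 'cV[R]_m)
    (g : S -> 'cV[R]_m) :
  measurable_fun setT f -> measurable_fun setT g ->
  measurable_fun setT (fun s => [tuple of rcons (f s) (g s)]).
Proof.
move=> mf mg; apply/measurable_fun_tnthP => i.
have [ni|ni] := ltnP i n.
  rewrite (_ : _ \o _ = fun s => tnth (f s) (Ordinal ni)).
    exact: (measurableT_comp (measurable_tnth _)).
  by apply/funext => s /=; rewrite !(tnth_nth 0) /= nth_rcons size_tuple ni.
rewrite (_ : _ \o _ = g)//; apply/funext => s /=.
have {ni} -> : i = ord_max.
  by apply/val_inj/eqP; rewrite /= eqn_leq ni -ltnS ltn_ord.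
by rewrite (tnth_nth 0) /= nth_rcons size_tuple ltnn eqxx.
Qed.

Lemma measurable_demand_upto k :
  (forall i, (i <= k)%N -> measurable_fun setT (x i)) ->
  measurable_fun setT (fun s => demand_upto (x ^~ s) k).
Proof.
move=> mx; apply/measurable_fun_tnthP => i.
rewrite (_ : _ \o _ = x i); first by apply: mx; rewrite -ltnS.
by apply/funext => s /=; rewrite tnth_mktuple.
Qed.

Variable pi : policy R m.

Lemma measurable_info_at k :
  (forall i, (i <= k)%N -> measurable_fun setT (x i)) ->
  measurable_fun setT (fun s => info_at pi (x ^~ s) k).
Proof.
move=> mx; apply: measurable_fun_pair; last exact: measurable_demand_upto.
elim: k mx => [|k IH] mx; first exact: measurable_cst.
have {}IH : measurable_fun setT (fun s => storage_upto pi (x ^~ s) k).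
  by apply: IH => i ik; apply: mx; exact: leqW.
apply: measurable_rcons_tuple => //; apply: measurable_matrixD.
  exact: (measurableT_comp (measurable_tnth _)).
apply: (measurableT_comp (pol_mu_measurable pi (k := k))).
apply: measurable_fun_pair => //; apply: measurable_demand_upto => i ik.
by apply: mx; exact: leqW.
Qed.

Lemma measurable_gen_input k :
  (forall i, (i <= k)%N -> measurable_fun setT (x i)) ->
  measurable_fun setT (fun s => gen_input pi (x ^~ s) k).
Proof.
move=> mx; apply: (measurableT_comp (pol_nu_measurable pi (k := k))).
exact: measurable_info_at.
Qed.

Lemma measurable_storage_input k :
  (forall i, (i <= k)%N -> measurable_fun setT (x i)) ->
  measurable_fun setT (fun s => storage_input pi (x ^~ s) k).
Proof.
move=> mx; apply: (measurableT_comp (pol_mu_measurable pi (k := k))).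
exact: measurable_info_at.
Qed.

Lemma measurable_storage_at k :
  (forall i, (i <= k)%N -> measurable_fun setT (x i)) ->
  measurable_fun setT (fun s => storage_at pi (x ^~ s) k).
Proof.
move=> mx; apply: (measurableT_comp (measurable_tnth _)).
exact: (measurableT_comp measurable_fst (measurable_info_at k mx)).
Qed.

End closed_loop_measurability.

Section open_loop.
Context (R : realType) (m : nat).
Implicit Types (pi : policy R m) (x : nat -> 'cV[R]_m).

Lemma storage_atS pi x k :
  storage_at pi x k.+1 = storage_at pi x k + storage_input pi x k.
Proof.
by rewrite [LHS](tnth_nth 0) /= nth_rcons size_tuple ltnn eqxx.
Qed.

Lemma eq_demand_upto x y k :
  (forall i, (i <= k)%N -> x i = y i) -> demand_upto x k = demand_upto y k.
Proof.
move=> xy; apply: eq_from_tnth => i; rewrite !tnth_mktuple xy//.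
by rewrite -ltnS.
Qed.

Lemma nth_demand_upto x k i : (i <= k)%N -> nth 0 (demand_upto x k) i = x i.
Proof.
rewrite -ltnS => ik.
by rewrite -[i]/(val (Ordinal ik)) -tnth_nth tnth_mktuple.
Qed.

Lemma measurable_nth_tuple k i : (i <= k)%N ->
  measurable_fun setT (fun X : k.+1.-tuple 'cV[R]_m => nth 0 X i).
Proof.
rewrite -ltnS => ik; rewrite (_ : (fun X => _) = @tnth _ _ ^~ (Ordinal ik)).
  exact: measurable_tnth.
by apply/funext => X; rewrite (tnth_nth 0).
Qed.

Lemma eq_info_at pi x y k :
  (forall i, (i <= k)%N -> x i = y i) -> info_at pi x k = info_at pi y k.
Proof.
move=> xy; rewrite /info_at (eq_demand_upto x y)//; congr pair.
elim: k xy => //= k IH xy; have {}IH : storage_upto pi x k = storage_upto pi y k.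
  by apply: IH => i ik; apply: xy; exact: leqW.
rewrite IH (eq_demand_upto x y)// => i ik.
by apply: xy; exact: leqW.
Qed.

(* [psi k] is the storage level at time [k.+1], chosen as a function of the
   demands up to time [k]. *)
Definition open_loop_storage (psi : forall k, k.+1.-tuple 'cV[R]_m -> 'cV[R]_m)
    x k : 'cV[R]_m :=
  if k is k'.+1 then psi k' (demand_upto x k') else 0.

Lemma eq_open_loop_storage psi x y k :
  (forall i, (i < k)%N -> x i = y i) ->
  open_loop_storage psi x k = open_loop_storage psi y k.
Proof. by case: k => //= k xy; rewrite (eq_demand_upto x y). Qed.

Lemma measurable_open_loop_storage d (S : measurableType d) psi
    (X : nat -> S -> 'cV[R]_m) k :
  (forall j, measurable_fun setT (psi j)) ->
  (forall i, (i < k)%N -> measurable_fun setT (X i)) ->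
  measurable_fun setT (fun s => open_loop_storage psi (X ^~ s) k).
Proof.
move=> mpsi; case: k => [|k] mX; first exact: measurable_cst.
by apply: (measurableT_comp (mpsi k)); exact: measurable_demand_upto.
Qed.

(** The policy charges the difference between the target level, computed from the demands, and the
    current level in its information; the storage therefore tracks the target exactly. *)
Lemma policy_of_open_loop (psi phi : forall k, k.+1.-tuple 'cV[R]_m -> 'cV[R]_m) :
  (forall k, measurable_fun setT (psi k)) ->
  (forall k, measurable_fun setT (phi k)) ->
  exists pi, forall x k,
    [/\ storage_at pi x k = open_loop_storage psi x k,
     storage_input pi x k
       = open_loop_storage psi x k.+1 - open_loop_storage psi x k
   & gen_input pi x k = phi k (demand_upto x k)].
Proof.
move=> mpsi mphi.
pose mu k (I : info R m k) := psi k I.2 - tnth I.1 ord_max.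
pose nu k (I : info R m k) := phi k I.2.
have mmu k : measurable_fun [set: info R m k] (mu k).
  apply: measurable_matrixB.
    exact: (measurableT_comp (mpsi k) measurable_snd).
  exact: (measurableT_comp (measurable_tnth _) measurable_fst).
have mnu k : measurable_fun [set: info R m k] (nu k).
  exact: (measurableT_comp (mphi k) measurable_snd).
pose pi := Policy mmu mnu; exists pi => x k.
have stE j : storage_at pi x j = open_loop_storage psi x j.
  case: j => [|j]; first by [].
  by rewrite storage_atS addrC subrK.
by split=> //; rewrite -(stE k.+1) -(stE k) storage_atS addrAC subrr add0r.
Qed.

(** The closed loop is deterministic given the demands, so past storage levels carry no extra
    information. *)
Lemma open_loop_of_policy pi :
  exists psi ups phi : forall k, k.+1.-tuple 'cV[R]_m -> 'cV[R]_m,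
  [/\ forall k, measurable_fun setT (psi k),
      forall k, measurable_fun setT (ups k),
      forall k, measurable_fun setT (phi k)
    & forall x k,
    [/\ storage_at pi x k = open_loop_storage psi x k,
     storage_input pi x k = ups k (demand_upto x k)
   & gen_input pi x k = phi k (demand_upto x k)]].
Proof.
(* The closed loop is replayed on the observed demands, continued by zero; by causality the
   continuation does not affect the values up to time [k]. *)
exists (fun k X => storage_at pi (nth 0 X) k + storage_input pi (nth 0 X) k).
exists (fun k X => storage_input pi (nth 0 X) k).
exists (fun k X => gen_input pi (nth 0 X) k).
have mups k : measurable_fun setT (fun X : k.+1.-tuple 'cV[R]_m =>
    storage_input pi (nth 0 X) k).
  exact: (measurable_storage_input _ _ _ _
    (fun i (X : k.+1.-tuple 'cV[R]_m) => nth 0 X i) pi k (measurable_nth_tuple k)).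
split=> //.
- move=> k; apply: measurable_matrixD; last exact: mups.
  exact: (measurable_storage_at _ _ _ _
    (fun i (X : k.+1.-tuple 'cV[R]_m) => nth 0 X i) pi k (measurable_nth_tuple k)).
- move=> k; exact: (measurable_gen_input _ _ _ _
    (fun i (X : k.+1.-tuple 'cV[R]_m) => nth 0 X i) pi k (measurable_nth_tuple k)).
- move=> x k.
  have infoE j : info_at pi (nth 0 (demand_upto x j)) j = info_at pi x j.
    by apply: eq_info_at => i; exact: nth_demand_upto.
  split; last 2 first.
  + by rewrite /storage_input infoE.
  + by rewrite /gen_input infoE.
  case: k => [|k]; first by [].
  rewrite storage_atS /= -[storage_at pi x k]/(tnth (info_at pi x k).1 ord_max).
  by rewrite /storage_input -infoE.
Qed.

End open_loop.

(** * Expectations of possibly non-integrable functions *)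

Section expectation_conventions.
Context d (T : measurableType d) (R : realType) (P : probability T R).
Implicit Types f h : T -> R.
Local Open Scope ereal_scope.

Lemma expectationE f : 'E_P[f] = \int[P]_t (f t)%:E.
Proof. by rewrite unlock. Qed.

(* Unconditional because [+oo - +oo = -oo]. *)
Lemma le_expectation_ae f h :
  measurable_fun setT f -> measurable_fun setT h ->
  {ae P, forall t, (f t <= h t)%R} -> 'E_P[f] <= 'E_P[h].
Proof.
move=> /measurable_EFinP mf /measurable_EFinP mh fh.
rewrite !expectationE integralE [leRHS]integralE; apply: leeB.
  apply: ae_ge0_le_integral => //; try exact: measurable_funepos.
  apply: filterS fh => t fht _.
  by apply: (@funepos_le _ _ [set t]); rewrite ?inE// => s; rewrite inE => ->.
apply: ae_ge0_le_integral => //; try exact: measurable_funeneg.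
apply: filterS fh => t fht _.
by apply: (@funeneg_le _ _ [set t]); rewrite ?inE// => s; rewrite inE => ->.
Qed.

(** With [+oo - +oo = -oo], a finite difference forces the integrals of both parts to be finite. *)
Lemma expectation_fin_num_integrable f : measurable_fun setT f ->
  'E_P[f] \is a fin_num -> P.-integrable setT (EFin \o f).
Proof.
move=> /measurable_EFinP mf; rewrite expectationE integralE => fin.
apply/integrableP; split => //.
have -> : (fun t => `|(EFin \o f) t|) = (EFin \o f)^\+ \+ (EFin \o f)^\-.
  by rewrite -fune_abse.
rewrite ge0_integralD//; [|exact: measurable_funepos|exact: measurable_funeneg].
have : 0 <= \int[P]_t (EFin \o f)^\+ t by exact: integral_ge0.
have : 0 <= \int[P]_t (EFin \o f)^\- t by exact: integral_ge0.
move: fin; case: (\int[P]_t _^\+ t) => [r| |]; case: (\int[P]_t _^\- t) => [s| |] //.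
by move=> _ _ _; rewrite -EFinD ltry.
Qed.

(** For finite expectations this is linearity. The delicate case is expectation [-oo], where adding
    a constant must not make the infinite integral of the negative part finite. *)
Lemma expectation_addr_le f (C : R) : measurable_fun setT f ->
  'E_P[fun t => f t + C]%R <= 'E_P[f] + C%:E.
Proof.
move=> mf; have mfC : measurable_fun setT (fun t => f t + C)%R.
  exact: measurable_funD.
have iC (c : R) : P.-integrable setT (EFin \o cst c).
  exact: finite_measure_integrable_cst.
have int_cst (c : R) : \int[P]_t c%:E = c%:E.
  rewrite -(expectationE (cst c)); exact: expectation_cst.
have addE h (c : R) : measurable_fun setT h -> 'E_P[h] \is a fin_num ->
    'E_P[fun t => h t + c]%R = 'E_P[h] + c%:E.
  move=> mh fin; rewrite !expectationE.
  under eq_integral do rewrite EFinD.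
  rewrite (@integralD _ _ _ P _ measurableT (EFin \o h) (EFin \o cst c))//; last first.
    exact: expectation_fin_num_integrable.
  by congr (_ + _); exact: int_cst.
case Ef: 'E_P[f] => [r| |].
- by rewrite addE ?Ef.
- by rewrite addye ?leey.
- case EfC: 'E_P[_] => [r| |] //.
    have := addE _ (- C)%R mfC; rewrite EfC => /(_ isT).
    rewrite (_ : (fun t => _) = f) ?Ef//.
    by apply/funext => t; rewrite addrK.
  have partsE h : 'E_P[h] = \int[P]_t (EFin \o h)^\+ t - \int[P]_t (EFin \o h)^\- t.
    by rewrite expectationE integralE.
  have mfE : measurable_fun setT (EFin \o f) by exact/measurable_EFinP.
  have mfCE : measurable_fun setT (EFin \o (fun t => f t + C)%R) by exact/measurable_EFinP.
  (* The shifted expectation is assumed to be [+oo], so its negative part has finite integral. The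
     negative part of [f] exceeds it by at most [|C|], which contradicts expectation [-oo] for
     [f]. *)
  have fin : \int[P]_t (EFin \o (fun t => f t + C)%R)^\- t < +oo.
    rewrite ltNge leye_eq; apply/negP => /eqP E; move: EfC.
    by rewrite partsE E addeNy.
  have : \int[P]_t (EFin \o f)^\- t < +oo.
    apply: (@le_lt_trans _ _ (\int[P]_t ((EFin \o (fun t => f t + C)%R)^\- t + `|C|%:E))).
      apply: ge0_le_integral => //.
      - exact: measurable_funeneg.
      - by apply: emeasurable_funD => //; exact: measurable_funeneg.
      move=> t _; rewrite !funenegE /= -!EFin_max lee_fin.
      rewrite ge_max; apply/andP; split.
        rewrite -lerBlDr le_max; apply/orP; left.
        by have := ler_norm C; lra.
      by rewrite addr_ge0// le_max lexx orbT.
    rewrite ge0_integralD//; last exact: measurable_funeneg.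
    by rewrite int_cst lte_add_pinfty ?ltry.
  move: Ef; rewrite partsE; have : 0 <= \int[P]_t (EFin \o f)^\+ t by exact: integral_ge0.
  by case: (\int[P]_t _^\+ t) => [r| |]; case: (\int[P]_t _^\- t) => [s| |].
Qed.

End expectation_conventions.

(** * Monotonicity and convexity of the optimal cost *)

Section optimal_cost_properties.
Context (R : realType) d (T : measurableType d) (P : probability T R).
Context (m l : nat) (G : network R m l) (alpha beta : 'cV[R]_m).
Hypothesis cost_coeffs : forall i, 0 <= beta i 0 <= alpha i 0.
Context (N : nat) (xi : nat -> T -> 'cV[R]_m).
Hypothesis xi_measurable : forall k, (k < N)%N -> measurable_fun setT (xi k).

Local Notation adm := (admissible P G N xi).
Local Notation g := (gen_cost alpha beta).
Local Notation J := (optimal_cost P G alpha beta N xi).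
Local Notation cost pi :=
  (fun t => \sum_(k < N) g (gen_input pi (xi ^~ t) k)).

Implicit Types (b : 'cV[R]_m) (pi : policy R m) (x : nat -> 'cV[R]_m).

Lemma ae_ltn n (Q : nat -> T -> Prop) :
  (forall k, (k < n)%N -> {ae P, forall t, Q k t}) ->
  {ae P, forall t, forall k, (k < n)%N -> Q k t}.
Proof.
move=> h; apply: ae_foralln => k; have [kn|nk] := ltnP k n.
  by apply: filterS (h k kn).
by apply: filterE.
Qed.

Lemma measurable_xi k i : (k < N)%N -> (i <= k)%N -> measurable_fun setT (xi i).
Proof. by move=> kN ik; apply: xi_measurable; exact: leq_ltn_trans kN. Qed.

Lemma measurable_cost pi : measurable_fun setT (cost pi).
Proof.
apply: measurable_sum => k.
apply: (measurableT_comp (measurable_gen_cost _ _ _ _)).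
by apply: measurable_gen_input => i; exact: measurable_xi.
Qed.

Lemma storage_set_dist b (z z' : 'cV[R]_m) i : storage_set b z ->
  storage_set b z' -> `|(z' - z) i 0| <= b i 0.
Proof.
move=> /(_ i)/andP[? ?] /(_ i)/andP[? ?]; rewrite !mxE ler_norml.
by apply/andP; split; lra.
Qed.

Lemma storage_set_convex b b' (z z' : 'cV[R]_m) (r : R) : 0 <= r <= 1 ->
  storage_set b z -> storage_set b' z' ->
  storage_set (r *: b + (1 - r) *: b') (r *: z + (1 - r) *: z').
Proof.
move=> /andP[r0 r1] hz hz' i; have /andP[? ?] := hz i; have /andP[? ?] := hz' i.
by rewrite !mxE; apply/andP; split; nra.
Qed.

Lemma admissible_storage_at b pi k : (forall i, 0 <= b i 0) -> (k <= N)%N ->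
  adm b pi -> {ae P, forall t, storage_set b (storage_at pi (xi ^~ t) k)}.
Proof.
case: k => [|k] b0 kN apb.
  by apply: filterE => t i; rewrite mxE lexx b0.
have [+ _] := apb k kN; apply: filterS => t.
by rewrite storage_atS.
Qed.

Lemma optimal_cost_le b pi : adm b pi ->
  (J b <= expected_cost P alpha beta N xi pi)%E.
Proof. by move=> ?; apply: ereal_inf_lbound; exists pi. Qed.

Lemma le_optimal_cost b (x : \bar R) :
  (forall pi, adm b pi -> (x <= expected_cost P alpha beta N xi pi)%E) ->
  (x <= J b)%E.
Proof. by move=> h; apply: le_ereal_inf_tmp => _ [pi apb <-]; exact: h. Qed.

(** Larger storage boxes admit more policies, so the infimum runs over a larger set. *)
Lemma optimal_cost_antitone b b' : (forall i, b i 0 <= b' i 0) ->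
  (J b' <= J b)%E.
Proof.
move=> bb'; apply: le_optimal_cost => pi apb; apply: optimal_cost_le => k kN.
have [st pol] := apb k kN; split=> //; apply: filterS st => t st i.
by have /andP[-> /le_trans->] := st i.
Qed.

(* Emptying the storage changes the cost by at most a constant, so that
   the optimal costs for different capacities are finite simultaneously. *)
Lemma optimal_cost_le_add b b' : (forall i, 0 <= b i 0) ->
  (forall i, 0 <= b' i 0) -> exists C : R, (J b' <= J b + C%:E)%E.
Proof.
move=> b0 b'0; pose C := \sum_(k < N) \sum_i alpha i 0 * b i 0; exists C.
rewrite -leeBlDr//; apply: le_optimal_cost => pi apb; rewrite leeBlDr//.
have [psi [ups [phi [mpsi mups mphi piE]]]] := open_loop_of_policy R m pi.
(* The storage stays empty and the generation becomes [v - u], which leaves the injection unchanged.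
   The extra term [- u] costs at most [alpha] per unit, and [|u| <= b] because consecutive levels
   lie in the box; this is where [C] comes from. *)
have [|k|pi' pi'E] := policy_of_open_loop R m (fun=> cst 0) (fun k X => phi k X - ups k X).
- by move=> k; exact: measurable_cst.
- by apply: measurable_matrixB; [exact: mphi|exact: mups].
have st0 x k : open_loop_storage R m (fun=> cst (0 : 'cV[R]_m)) x k = 0 by case: k.
have gen'E x k : gen_input pi' x k = gen_input pi x k - storage_input pi x k.
  by have [_ _ ->] := pi'E x k; have [_ -> ->] := piE x k.
have ap' : adm b' pi'.
  move=> k kN; have [_ pol] := apb k kN; split.
    apply: filterE => t; have [-> -> _] := pi'E (xi ^~ t) k; rewrite !st0 => i.
    by rewrite !mxE subr0 addr0 lexx b'0.
  apply: filterS pol => t; rewrite gen'E.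
  by have [_ -> _] := pi'E (xi ^~ t) k; rewrite !st0 !subr0.
apply: le_trans (optimal_cost_le _ _ ap') _.
apply: le_trans (expectation_addr_le _ _ _ _ _ _ _); last exact: measurable_cost.
apply: le_expectation_ae; first exact: measurable_cost.
  by apply: measurable_funD => //; exact: measurable_cost.
have h1 := ae_ltn N _ (fun k kN => admissible_storage_at b pi k b0 (ltnW kN) apb).
have h2 := ae_ltn N _ (fun k kN => proj1 (apb k kN)).
apply: filterS2 h1 h2 => t h1 h2.
rewrite /C -big_split; apply: ler_sum => k _ /=.
rewrite gen'E; apply: le_trans (gen_costD_le _ _ _ _ cost_coeffs _ _) _.
rewrite lerD2l; apply: le_trans (gen_cost_le_abs _ _ _ _ cost_coeffs _) _.
apply: ler_sum => i _; have /andP[be0 ab] := cost_coeffs i.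
apply: ler_wpM2l; first exact: le_trans ab.
have := storage_set_dist _ _ _ i (h1 k (ltn_ord k)) (h2 k (ltn_ord k)).
by rewrite addrAC subrr add0r mxE normrN.
Qed.

(** The trajectories are averaged for the same demands, not the feedback maps, whose arguments
    differ because the two closed loops hold different storage levels. Finite costs make the
    integral linear. *)
Lemma expected_cost_convex b b' (r : R) pi pi' : 0 <= r <= 1 ->
  adm b pi -> adm b' pi' ->
  expected_cost P alpha beta N xi pi \is a fin_num ->
  expected_cost P alpha beta N xi pi' \is a fin_num ->
  (J (r *: b + (1 - r) *: b') <= r%:E * expected_cost P alpha beta N xi pi
     + (1 - r)%:E * expected_cost P alpha beta N xi pi')%E.
Proof.
move=> r01 apb apb' fin fin'.
have [psi [ups [phi [mpsi mups mphi piE]]]] := open_loop_of_policy R m pi.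
have [psi' [ups' [phi' [mpsi' mups' mphi' piE']]]] := open_loop_of_policy R m pi'.
have [k|k|pr prE] := policy_of_open_loop R m
  (fun k X => r *: psi k X + (1 - r) *: psi' k X)
  (fun k X => r *: phi k X + (1 - r) *: phi' k X).
- by apply: measurable_matrixD; apply: measurable_matrixZ; [exact: mpsi|exact: mpsi'].
- by apply: measurable_matrixD; apply: measurable_matrixZ; [exact: mphi|exact: mphi'].
have stE x k : storage_at pr x k
    = r *: storage_at pi x k + (1 - r) *: storage_at pi' x k.
  have [-> _ _] := prE x k; have [-> _ _] := piE x k; have [-> _ _] := piE' x k.
  by case: k => //; rewrite !scaler0 addr0.
have stiE x k : storage_input pr x k
    = r *: storage_input pi x k + (1 - r) *: storage_input pi' x k.
  (* The inputs are increments of the levels, so their averaging follows from that of consecutive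
     levels. *)
  apply: (addrI (storage_at pr x k)).
  by rewrite -storage_atS !stE !storage_atS !scalerDr addrACA.
have genE x k : gen_input pr x k
    = r *: gen_input pi x k + (1 - r) *: gen_input pi' x k.
  by have [_ _ ->] := prE x k; have [_ _ ->] := piE x k; have [_ _ ->] := piE' x k.
have ap : adm (r *: b + (1 - r) *: b') pr.
  move=> k kN; have [s1 p1] := apb k kN; have [s2 p2] := apb' k kN; split.
    apply: filterS2 s1 s2 => t s1 s2; rewrite -storage_atS stE !storage_atS.
    exact: storage_set_convex.
  apply: filterS2 p1 p2 => t p1 p2.
  have := injection_polytope_convex _ _ _ _ r _ _ r01 p1 p2.
  rewrite genE stiE; congr (injection_polytope G _).
  by apply/colP => i; rewrite !mxE; ring.
apply: le_trans (optimal_cost_le _ _ ap) _.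
have mc p := measurable_cost p.
have ip := expectation_fin_num_integrable _ _ _ _ _ (mc pi) fin.
have ip' := expectation_fin_num_integrable _ _ _ _ _ (mc pi') fin'.
rewrite /expected_cost !expectationE.
rewrite -(integralZl measurableT ip) -(integralZl measurableT ip').
rewrite -(integralD measurableT (integrableZl measurableT r ip)
  (integrableZl measurableT (1 - r) ip')).
rewrite -[leLHS]expectationE.
rewrite (_ : (fun t => _) = (fun t => (r * cost pi t + (1 - r) * cost pi' t)%:E))//.
rewrite -expectationE; apply: le_expectation_ae => //.
  by apply: measurable_funD; apply: measurable_funM.
apply: filterE => t; rewrite !mulr_sumr -big_split; apply: ler_sum => k _ /=.
by rewrite genE; exact: gen_cost_convex.
Qed.

Lemma optimal_cost_convex b b' (r : R) :
  (forall i, 0 <= b i 0) -> (forall i, 0 <= b' i 0) -> 0 <= r <= 1 ->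
  (J (r *: b + (1 - r) *: b') <= r%:E * J b + (1 - r)%:E * J b')%E.
Proof.
move=> b0 b'0 r01; have /andP[r0 r1] := r01.
pose b2 := r *: b + (1 - r) *: b'.
have b20 i : 0 <= b2 i 0.
  by rewrite !mxE addr_ge0// mulr_ge0 ?subr_ge0.
have [C1 h1] := optimal_cost_le_add _ _ b0 b'0.
have [C2 h2] := optimal_cost_le_add _ _ b'0 b0.
have [C3 h3] := optimal_cost_le_add _ _ b0 b20.
rewrite -/b2.
case Jb: (J b) h1 h2 h3 => [x| |] h1 h2 h3.
- have [y Jb'] : exists y, J b' = y%:E.
    by move: h1 h2; case: (J b') => [y| |] //; exists y.
  rewrite Jb'; apply/lee_addgt0Pr => e e0.
  have [|_ [pi ap <-] lpi] := lb_ereal_inf_adherent e0 (_ : J b \is a fin_num).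
    by rewrite Jb.
  have [|_ [pi' ap' <-] lpi'] := lb_ereal_inf_adherent e0 (_ : J b' \is a fin_num).
    by rewrite Jb'.
  rewrite -[ereal_inf _]/(J b) Jb in lpi; rewrite -[ereal_inf _]/(J b') Jb' in lpi'.
  have gpi := optimal_cost_le _ _ ap; rewrite Jb in gpi.
  have gpi' := optimal_cost_le _ _ ap'; rewrite Jb' in gpi'.
  have := expected_cost_convex _ _ r _ _ r01 ap ap'.
  (* Both expected costs lie between the infimum and the infimum plus [e], hence are finite. *)
  move: gpi gpi' lpi lpi'.
  case: (expected_cost _ _ _ _ _ pi) => [u| |] //.
  case: (expected_cost _ _ _ _ _ pi') => [v| |] // _ _.
  rewrite -!EFinD !lte_fin => ux vy /(_ isT isT) /le_trans; apply.
  by rewrite lee_fin; nra.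
- have -> : J b' = +oo%E by move: h2; case: (J b').
  (* For [r = 0] the first product is [0 * +oo = 0], and the right-hand side is infinite through its
     second term instead. *)
  have [->|r_neq0] := eqVneq r 0.
    by rewrite subr0 mul0e mul1e add0e leey.
  rewrite gt0_muley ?lte_fin ?lt0r ?r_neq0//.
  rewrite addye ?leey// -ltNye (lt_le_trans (ltNyr 0))//.
  by rewrite mule_ge0 ?lee_fin ?subr_ge0 ?leey.
- by move: h3; rewrite addNye leeNy_eq => /eqP ->; rewrite leNye.
Qed.

End optimal_cost_properties.

(** * Existence of an optimal policy *)

Lemma cvg_bigsum (R : realType) (J : Type) (s : seq J) (F : J -> nat -> R)
    (a : J -> R) :
  (forall j, F j n @[n --> \oo] --> a j) ->
  \sum_(j <- s) F j n @[n --> \oo] --> \sum_(j <- s) a j.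
Proof.
move=> h; elim: s => [|j s IH].
  rewrite big_nil; under eq_fun do rewrite big_nil; exact: cvg_cst.
by rewrite big_cons; under eq_fun do rewrite big_cons; exact: cvgD.
Qed.

Lemma geometric_increments_cvg (R : realType) (u : nat -> R) (B : R) :
  (forall n, `|u n.+1 - u n| <= B * (2^-1) ^+ n) -> cvgn u.
Proof.
move=> hu.
have cv : cvgn (series (telescope u)).
  apply: normed_cvg; apply: (@series_le_cvg _ _ (geometric B 2^-1)).
  - by move=> n; exact: normr_ge0.
  - by move=> n; apply: le_trans (hu n); exact: normr_ge0.
  - by move=> n; exact: hu.
  - apply: is_cvg_geometric_series.
    by rewrite ger0_norm ?invr_ge0// invf_lt1// ltr1n.
have -> : u = (fun n => u 0%N + series (telescope u) n).
  by apply/funext => n; exact: eq_sum_telescope.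
by apply: is_cvgD => //; exact: is_cvg_cst.
Qed.

(** The series of the [f n] has integral at most [1], hence is almost surely finite, and its sum
    bounds every term. *)
Lemma ae_bounded_of_summable d (T : measurableType d) (R : realType)
    (P : probability T R) (f : nat -> T -> R) :
  (forall n, measurable_fun setT (f n)) -> (forall n t, 0 <= f n t) ->
  (forall n, (\int[P]_t (f n t)%:E <= (1 / (2 ^ n.+1)%:R)%:E)%E) ->
  {ae P, forall t, exists B, forall n, f n t <= B}.
Proof.
move=> mf f0 intf.
have mfE n : measurable_fun setT (fun t => (f n t)%:E) by exact/measurable_EFinP.
pose S t := (\sum_(0 <= n <oo) (f n t)%:E)%E.
have S0 t : (0 <= S t)%E by apply: nneseries_ge0 => n _ _; rewrite lee_fin.
have mS : measurable_fun setT S.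
  by apply: ge0_emeasurable_sum => // n t _ _; rewrite lee_fin.
have intS : P.-integrable setT S.
  apply/integrableP; split => //.
  under eq_integral do rewrite gee0_abs//.
  rewrite /S (@integral_nneseries _ _ _ P _ measurableT)//; last first.
    by move=> n t _; rewrite lee_fin.
  apply: le_lt_trans (ltry 1); apply: le_trans (epsilon_trick0 xpredT ler01).
  apply: lee_nneseries => n *; last exact: intf.
  by apply: integral_ge0 => t _; rewrite lee_fin.
have := integrable_ae measurableT intS; apply: filterS => t /(_ Logic.I) St.
exists (fine (S t)) => n; rewrite -lee_fin fineK//.
apply: le_trans (nneseries_lim_ge n.+1 _) => [|k _ _]; last by rewrite lee_fin.
rewrite big_mkord big_ord_recr /= leeDr//.
by apply: sume_ge0 => k _; rewrite lee_fin.
Qed.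

(* Abstract form of the projection argument in a Hilbert space: among nearly
   optimal points take those of nearly minimal norm [q]; the parallelogram
   inequality forces them to be close for the squared distance [D]. *)
Lemma minimizing_cauchy_sequence (R : realType) (X : Type) (Phi q : X -> R)
    (D : X -> X -> R) (mid : X -> X -> X) (x0 : X) (B M : R) (e : nat -> R) :
  (forall x, B <= Phi x) -> (forall x, 0 <= q x <= M) ->
  (forall x y, Phi (mid x y) <= (Phi x + Phi y) / 2) ->
  (forall x y, D x y <= 2 * (q x + q y) - 4 * q (mid x y)) ->
  (forall n, 0 < e n) -> (forall n, e n.+1 <= e n) ->
  exists u : nat -> X, (forall n x, Phi (u n) <= Phi x + e n) /\
    (forall n, D (u n) (u n.+1) <= 8 * e n).
Proof.
move=> PhiB qM Phimid Dmid e0 edec.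
pose V := inf (range Phi).
have infP : has_inf (range Phi).
  by split; [exists (Phi x0), x0|exists B => _ [x _ <-]].
have VPhi x : V <= Phi x by apply: ge_inf; [case: infP|exists x].
have Vadh r : 0 < r -> exists x, Phi x <= V + r.
  by move=> /(inf_adherent)/(_ infP)[_ [x _ <-]] /ltW; exists x.
pose A := [set r | forall c, 0 < c -> exists2 x, Phi x <= V + c & q x <= r].
have infA : has_inf A.
  split.
    exists M => c /Vadh[x hx]; exists x => //.
    by have /andP[] := qM x.
  exists 0 => r /(_ 1 ltr01)[x _]; apply: le_trans.
  by have /andP[] := qM x.
(* The second component is a tolerance so small that no point this close to optimal has norm below
   [inf A - e n]. *)
have near_opt n : exists xc : X * R, [/\ 0 < xc.2 <= e n,
    Phi xc.1 <= V + xc.2, q xc.1 <= inf A + e n &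
    forall y, Phi y <= V + xc.2 -> inf A - e n <= q y].
  have [c [c0 hc]] : exists c, 0 < c /\
      forall y, Phi y <= V + c -> inf A - e n <= q y.
    apply: contrapT => /forallNP H.
    have : A (inf A - e n).
      move=> c c0; have /not_andP[//|/existsNP[y /not_implyP[hy qy]]] := H c.
      by exists y => //; rewrite leNgt; apply/negP => /ltW.
    move/(ge_inf (proj2 infA)); have := e0 n; lra.
  pose c' := Num.min c (e n).
  have c'0 : 0 < c' by rewrite lt_min c0 e0.
  have [a Aa ae] := inf_adherent (e0 n) infA.
  have [x hx qx] := Aa c' c'0.
  exists (x, c'); split => //=.
  - by rewrite c'0 ge_min lexx orbT.
  - exact: le_trans (ltW ae).
  - move=> y hy; apply: hc; apply: le_trans hy _.
    by rewrite lerD2l ge_min lexx.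
have /choice[xc xcP] := near_opt.
exists (fun n => (xc n).1); split.
  move=> n x; have [/andP[_ ce] hx _ _] := xcP n.
  by apply: le_trans hx _; exact: lerD.
move=> n; apply: le_trans (Dmid _ _) _.
have [/andP[c0 ce] hx qx lbx] := xcP n.
have [/andP[c0' ce'] hx' qx' lbx'] := xcP n.+1.
have := Phimid (xc n).1 (xc n.+1).1.
set y := mid _ _ => hy.
have := edec n; have := e0 n => en0 en1.
(* The midpoint is optimal up to the larger of the two tolerances, so the norm bound of that index
   applies. The errors then add up to at most [2 + 2 + 4 = 8] times [e n]. *)
have [cc|cc] := leP (xc n.+1).2 (xc n).2.
  have /lbx : Phi y <= V + (xc n).2 by lra.
  by lra.
have /lbx' : Phi y <= V + (xc n.+1).2 by lra.
by lra.
Qed.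

Section existence.
Context (R : realType) d (T : measurableType d) (P : probability T R).
Context (m l : nat) (G : network R m l) (alpha beta : 'cV[R]_m).
Hypothesis cost_coeffs : forall i, 0 <= beta i 0 <= alpha i 0.
Context (N : nat) (xi : nat -> T -> 'cV[R]_m).
Hypothesis xi_measurable : forall k, (k < N)%N -> measurable_fun setT (xi k).
Context (b : 'cV[R]_m).
Hypothesis b_ge0 : forall i, 0 <= b i 0.
Context (h : 'cV[R]_m -> R) (s : 'cV[R]_m -> 'cV[R]_m).
Hypothesis mh : measurable_fun setT h.
Hypothesis ms : measurable_fun setT s.
Hypothesis hs : forall w,
  injection_polytope G (s w) /\ gen_cost alpha beta (w + s w) = h w.
Hypothesis h_min : forall w p,
  injection_polytope G p -> h w <= gen_cost alpha beta (w + p).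

Local Notation adm := (admissible P G N xi).
Local Notation g := (gen_cost alpha beta).
Local Notation cost pi :=
  (fun t => \sum_(k < N) g (gen_input pi (xi ^~ t) k)).
Local Notation open_loop := (forall k, k.+1.-tuple 'cV[R]_m -> 'cV[R]_m).
Implicit Types (psi : open_loop) (pi : policy R m) (t : T) (w v : 'cV[R]_m).

(** * Regularity of the minimal generation cost [h] *)

Let alpha_ge0 i : 0 <= alpha i 0.
Proof. by have /andP[b0 ab] := cost_coeffs i; exact: le_trans ab. Qed.

(** The injection that is optimal for [w'] remains available at [w]; the generation changes by
    [w - w'], at a price of at most [alpha] per unit. *)
Let h_lipschitz w w' : h w <= h w' + \sum_i alpha i 0 * `|(w - w') i 0|.
Proof.
have [Pw' <-] := hs w'; apply: le_trans (h_min w _ Pw') _.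
rewrite -[in leLHS](subrK w' w) -addrA addrC.
apply: le_trans (gen_costD_le _ _ _ _ cost_coeffs _ _) _.
by rewrite lerD2l; exact: gen_cost_le_abs.
Qed.

(** The same average of the two optimal injections lies in the convex polytope and is a competitor
    at the averaged point. *)
Let h_convex (r : R) w w' : 0 <= r <= 1 ->
  h (r *: w + (1 - r) *: w') <= r * h w + (1 - r) * h w'.
Proof.
move=> r01; have [Pw Ew] := hs w; have [Pw' Ew'] := hs w'.
have := h_min (r *: w + (1 - r) *: w') _
  (injection_polytope_convex _ _ _ _ r _ _ r01 Pw Pw').
move/le_trans; apply; rewrite -Ew -Ew' addrACA -!scalerDr.
exact: gen_cost_convex.
Qed.

Let h_cvg (u : nat -> 'cV[R]_m) w :
  (forall i, u n i 0 @[n --> \oo] --> w i 0) -> h (u n) @[n --> \oo] --> h w.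
Proof.
move=> uw.
have cv (e : nat -> 'cV[R]_m) : (forall i, e n i 0 @[n --> \oo] --> (0 : R)) ->
    \sum_i alpha i 0 * `|e n i 0| @[n --> \oo] --> (0 : R).
  move=> e0; rewrite [X in _ --> X](_ : 0 = \sum_(i < m) alpha i 0 * `|0 : R|); last first.
    by rewrite big1// => i _; rewrite normr0 mulr0.
  apply: (cvg_bigsum _ _ _ (fun i n => alpha i 0 * `|e n i 0|)) => i.
  by apply: cvgMr; apply: cvg_norm; exact: e0.
have cv1 : \sum_i alpha i 0 * `|(w - u n) i 0| @[n --> \oo] --> (0 : R).
  apply: cv => i; rewrite -(subrr (w i 0)).
  under eq_fun do rewrite !mxE.
  by apply: cvgB => //; exact: cvg_cst.
have cv2 : \sum_i alpha i 0 * `|(u n - w) i 0| @[n --> \oo] --> (0 : R).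
  apply: cv => i; rewrite -(subrr (w i 0)).
  under eq_fun do rewrite !mxE.
  by apply: cvgB => //; exact: cvg_cst.
apply: (@squeeze_cvgr _ _ _ _
  (fun n => h w - \sum_i alpha i 0 * `|(w - u n) i 0|)
  (fun n => h w + \sum_i alpha i 0 * `|(u n - w) i 0|)).
- by apply: nearW => n; rewrite lerBlDr !h_lipschitz.
- by rewrite -[X in _ --> X]subr0; apply: cvgB => //; exact: cvg_cst.
- by rewrite -[X in _ --> X]addr0; apply: cvgD => //; exact: cvg_cst.
Qed.

(** * Reduction to storage strategies that stay in the box *)

Let clip v : 'cV[R]_m := \col_i Num.min (Num.max 0 (v i 0)) (b i 0).

Let clip_box v : storage_set b (clip v).
Proof.
by move=> i; rewrite mxE le_min b_ge0 le_max lexx/= ge_min lexx orbT.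
Qed.

Let clip_id v : storage_set b v -> clip v = v.
Proof.
move=> vb; apply/colP => i; have /andP[v0 v1] := vb i.
by rewrite mxE (max_r v0) (min_l v1).
Qed.

Let measurable_clip : measurable_fun setT clip.
Proof.
apply: measurable_matrix => i j.
rewrite (_ : (fun v => _) = fun v => Num.min (Num.max 0 (v i 0)) (b i 0)).
  apply: measurable_minr => //; apply: measurable_maxr => //.
  exact: measurable_entry.
by apply/funext => v; rewrite mxE.
Qed.

(** The box constraint is imposed on every demand history, not just almost surely, so that bounds
    hold pointwise; [clip] makes this no restriction. *)
Let feasible psi := (forall k, measurable_fun setT (psi k)) /\
  (forall k X, storage_set b (psi k X)).

Let z psi k t := open_loop_storage R m psi (xi ^~ t) k.

(** Generation is already minimized out: with injection [p] it equals demand plus storage input plus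
    [p]. *)
Let c psi t := \sum_(k < N) h (xi k t + (z psi k.+1 t - z psi k t)).

Let measurable_z psi k : feasible psi -> (k <= N)%N ->
  measurable_fun setT (z psi k).
Proof.
move=> [mpsi _] kN; apply: measurable_open_loop_storage => // i ik.
by apply: xi_measurable; exact: leq_trans kN.
Qed.

Let z_box psi k t : feasible psi -> storage_set b (z psi k t).
Proof.
move=> [_ bpsi]; case: k => [|k]; last exact: bpsi.
by move=> i; rewrite /z /= mxE lexx b_ge0.
Qed.

Let measurable_c psi : feasible psi -> measurable_fun setT (c psi).
Proof.
move=> fpsi; apply: measurable_sum => k; apply: (measurableT_comp mh).
apply: measurable_matrixD; first exact: xi_measurable.
by apply: measurable_matrixB; apply: measurable_z => //; exact: ltnW.
Qed.

(** Storage increments lie between [- b] and [b], so those of two strategies differ by at most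
    [2 * b]. *)
Let kappa : R := \sum_(k < N) \sum_i alpha i 0 * (2 * b i 0).

Let c_le psi psi' t : feasible psi -> feasible psi' ->
  c psi t <= c psi' t + kappa.
Proof.
move=> fpsi fpsi'; rewrite -big_split; apply: ler_sum => k _ /=.
apply: le_trans (h_lipschitz _ (xi k t + (z psi' k.+1 t - z psi' k t))) _.
rewrite lerD2l.
apply: ler_sum => i _; apply: ler_wpM2l => //.
have := z_box _ k t fpsi i; have := z_box _ k t fpsi' i.
have := z_box _ k.+1 t fpsi i; have := z_box _ k.+1 t fpsi' i.
move=> /andP[? ?] /andP[? ?] /andP[? ?] /andP[? ?].
by rewrite !mxE ler_norml; apply/andP; split; lra.
Qed.

Let expected_cost_ge pi : adm b pi ->
  exists2 psi, feasible psi & ('E_P[c psi] <= expected_cost P alpha beta N xi pi)%E.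
Proof.
move=> apb; have [psi0 [ups [phi [mpsi0 mups mphi piE]]]] := open_loop_of_policy R m pi.
pose psi k X := clip (psi0 k X).
have fpsi : feasible psi.
  by split=> [k|k X]; [exact: (measurableT_comp measurable_clip (mpsi0 k))|exact: clip_box].
exists psi => //; apply: le_expectation_ae.
- exact: measurable_c.
- exact: measurable_cost.
(* Levels are needed at the times [0] to [N], one more than the number of injections. *)
have h1 := ae_ltn _ _ _ _ N.+1 _
  (fun k kN => admissible_storage_at _ _ _ P _ _ G N xi b pi k b_ge0 kN apb).
have h2 := ae_ltn _ _ _ _ N _ (fun k kN => proj2 (apb k kN)).
apply: filterS2 h1 h2 => t h1 h2.
have zE k : (k <= N)%N -> z psi k t = storage_at pi (xi ^~ t) k.
  move=> kN; have [stE _ _] := piE (xi ^~ t) k.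
  have := h1 k kN; rewrite stE /z; case: k {kN stE} => //= k.
  exact: clip_id.
apply: ler_sum => k _; rewrite !zE//; last exact: ltnW.
rewrite storage_atS [_ + storage_input _ _ _]addrC addrK.
have := h_min (xi k t + storage_input pi (xi ^~ t) k) _ (h2 k (ltn_ord k)).
move/le_trans; apply; rewrite le_eqVlt; apply/orP; left; apply/eqP.
by congr (g _); apply/colP => i; rewrite !mxE; ring.
Qed.

(** Generating [w + s w] makes the injection equal to [s w], which lies in the polytope and attains
    [h w]; measurability of [s] makes this a policy. *)
Let expected_cost_feasible psi : feasible psi ->
  exists2 pi, adm b pi & expected_cost P alpha beta N xi pi = ('E_P[c psi])%E.
Proof.
move=> fpsi; have [mpsi bpsi] := fpsi.
pose ol := open_loop_storage R m psi.
pose w (x : nat -> 'cV[R]_m) k := x k + (ol x k.+1 - ol x k).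
pose phi k (X : k.+1.-tuple 'cV[R]_m) := w (nth 0 X) k + s (w (nth 0 X) k).
have mol k j : (j <= k.+1)%N ->
    measurable_fun setT (fun X : k.+1.-tuple 'cV[R]_m => ol (nth 0 X) j).
  move=> jk; apply: (measurable_open_loop_storage _ _ _ _ _
    (fun i (X : k.+1.-tuple 'cV[R]_m) => nth 0 X i)) => // i ij.
  by apply: measurable_nth_tuple; rewrite -ltnS; exact: leq_trans jk.
have mphi k : measurable_fun setT (phi k).
  have mw : measurable_fun setT (fun X : k.+1.-tuple 'cV[R]_m => w (nth 0 X) k).
    apply: measurable_matrixD; first exact: measurable_nth_tuple.
    by apply: measurable_matrixB; exact: mol.
  by apply: measurable_matrixD => //; exact: (measurableT_comp ms mw).
have [pi piE] := policy_of_open_loop R m psi phi mpsi mphi.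
have genE x k : gen_input pi x k = w x k + s (w x k).
  have [_ _ ->] := piE x k.
  have olE j : (j <= k.+1)%N -> ol (nth 0 (demand_upto x k)) j = ol x j.
    move=> jk; apply: eq_open_loop_storage => i ij.
    by apply: nth_demand_upto; rewrite -ltnS; exact: leq_trans jk.
  by rewrite /phi /w !olE// nth_demand_upto.
exists pi.
  move=> k kN; split; apply: filterE => t.
    by rewrite -storage_atS; have [-> _ _] := piE (xi ^~ t) k.+1; exact: (z_box psi k.+1).
  have [_ stE _] := piE (xi ^~ t) k; rewrite genE stE.
  have [+ _] := hs (w (xi ^~ t) k); congr (injection_polytope G _).
  by apply/colP => i; rewrite /w !mxE; ring.
rewrite /expected_cost (_ : (fun t => _) = c psi)//; apply/funext => t.
by apply: eq_bigr => k _; rewrite genE; have [_ ->] := hs (w (xi ^~ t) k).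
Qed.

(** Empty storage is both the reference for bounding costs and the origin for the squared norm. *)
Let zero : open_loop := fun k => cst 0.

Let feasible_zero : feasible zero.
Proof.
by split=> [k|k X i]; [exact: measurable_cst|rewrite mxE lexx b_ge0].
Qed.

Let c_dominated psi t : feasible psi -> `|c psi t| <= `|c zero t| + kappa.
Proof.
move=> fpsi; have := c_le _ _ t fpsi feasible_zero.
have := c_le _ _ t feasible_zero fpsi.
have := ler_norm (c zero t); have := ler_norm (- c zero t); rewrite normrN.
by move=> *; rewrite ler_norml; apply/andP; split; lra.
Qed.

(* The cost of any strategy is within [kappa] of that of [zero], hence equal
   to it when the latter is infinite. *)
Let zero_minimal psi : feasible psi -> ('E_P[c zero] \isn't a fin_num)%E ->
  ('E_P[c zero] <= 'E_P[c psi])%E.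
Proof.
move=> fpsi.
have : ('E_P[c zero] <= 'E_P[c psi] + kappa%:E)%E.
  apply: le_trans (expectation_addr_le _ _ _ P _ kappa (measurable_c _ fpsi)).
  apply: le_expectation_ae; first exact: measurable_c.
    by apply: measurable_funD => //; exact: measurable_c.
  by apply: filterE => t; exact: c_le.
case: ('E_P[c zero])%E => //= [|_ _]; last exact: leNye.
by rewrite !leye_eq; case: ('E_P[c psi])%E.
Qed.

(** * Midpoints and squared distances of strategies *)

Let sqdist psi psi' t :=
  \sum_(k < N) \sum_i (z psi k.+1 t i 0 - z psi' k.+1 t i 0) ^+ 2.

Let mid psi psi' : open_loop :=
  fun k X => 2^-1 *: psi k X + (1 - 2^-1) *: psi' k X.

Let half01 : 0 <= (2^-1 : R) <= 1.
Proof. by rewrite invr_ge0 ler0n invf_le1// ler1n. Qed.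

Let feasible_mid psi psi' : feasible psi -> feasible psi' ->
  feasible (mid psi psi').
Proof.
move=> [mpsi bpsi] [mpsi' bpsi']; split=> [k|k X].
  apply: measurable_matrixD; apply: measurable_matrixZ; [exact: mpsi|exact: mpsi'].
have := storage_set_convex _ _ _ _ _ _ _ half01 (bpsi k X) (bpsi' k X).
by rewrite -scalerDl addrC subrK scale1r.
Qed.

Let z_mid psi psi' k t :
  z (mid psi psi') k t = 2^-1 *: z psi k t + (1 - 2^-1) *: z psi' k t.
Proof. by case: k => [|k] //; rewrite /z /= !scaler0 addr0. Qed.

Let c_mid psi psi' t : c (mid psi psi') t <= (c psi t + c psi' t) / 2.
Proof.
rewrite mulrDl !mulr_suml -big_split; apply: ler_sum => k _ /=.
have := h_convex 2^-1 (xi k t + (z psi k.+1 t - z psi k t))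
  (xi k t + (z psi' k.+1 t - z psi' k t)) half01.
rewrite (_ : _ *: _ + _ = xi k t +
  (z (mid psi psi') k.+1 t - z (mid psi psi') k t)); last first.
  by rewrite !z_mid; apply/colP => i; rewrite !mxE; field.
by move/le_trans; apply; lra.
Qed.

(** This is the parallelogram identity, applied entry by entry for each demand path, with [zero] as
    origin. *)
Let sqdist_mid psi psi' t : sqdist psi psi' t =
  2 * (sqdist psi zero t + sqdist psi' zero t) - 4 * sqdist (mid psi psi') zero t.
Proof.
have parallelogram (x y w o : R) : w = 2^-1 * x + (1 - 2^-1) * y -> o = 0 ->
    (x - y) ^+ 2 = 2 * ((x - o) ^+ 2 + (y - o) ^+ 2) - 4 * (w - o) ^+ 2.
  by move=> -> ->; field.
rewrite /sqdist -big_split !mulr_sumr -sumrB; apply: eq_bigr => k _.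
rewrite -big_split !mulr_sumr -sumrB; apply: eq_bigr => i _.
apply: parallelogram; first by rewrite z_mid !mxE.
by rewrite /z /= mxE.
Qed.

Let sqdist_ge0 psi psi' t : 0 <= sqdist psi psi' t.
Proof. by apply: sumr_ge0 => k _; apply: sumr_ge0 => i _; exact: sqr_ge0. Qed.

Let diam : R := \sum_(k < N) \sum_i b i 0 ^+ 2.

Let sqdist_le psi psi' t : feasible psi -> feasible psi' ->
  sqdist psi psi' t <= diam.
Proof.
move=> fpsi fpsi'; apply: ler_sum => k _; apply: ler_sum => i _.
have /andP[? ?] := z_box _ k.+1 t fpsi i.
have /andP[? ?] := z_box _ k.+1 t fpsi' i.
by nra.
Qed.

Let measurable_sqdist psi psi' : feasible psi -> feasible psi' ->
  measurable_fun setT (sqdist psi psi').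
Proof.
move=> fpsi fpsi'; apply: measurable_sum => k; apply: measurable_sum => i.
apply: measurable_funX; apply: measurable_funB; apply: measurable_matrix_entry;
  exact: measurable_z.
Qed.

Let integrable_sqdist psi psi' : feasible psi -> feasible psi' ->
  P.-integrable setT (EFin \o sqdist psi psi').
Proof.
move=> fpsi fpsi'; apply: (@le_integrable _ _ _ P _ measurableT _ (EFin \o cst diam)).
- exact/measurable_EFinP/measurable_sqdist.
- move=> t _ /=; rewrite lee_fin ger0_norm ?sqdist_ge0//.
  by apply: le_trans (ler_norm _); exact: sqdist_le.
- exact: finite_measure_integrable_cst.
Qed.

(** * Existence of a minimizer when empty storage has finite expected cost *)

Section finite_cost.
Hypothesis zero_fin : ('E_P[c zero])%E \is a fin_num.

Let integrable_bound : P.-integrable setT (fun t => (`|c zero t| + kappa)%:E).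
Proof.
have i0 : P.-integrable setT (EFin \o c zero).
  exact: expectation_fin_num_integrable (measurable_c _ feasible_zero) zero_fin.
have := integrableD measurableT (integrable_abse i0)
  (finite_measure_integrable_cst P kappa measurableT).
by [].
Qed.

Let integrable_c psi : feasible psi -> P.-integrable setT (EFin \o c psi).
Proof.
move=> fpsi; apply: (le_integrable measurableT _ _ integrable_bound).
- exact/measurable_EFinP/measurable_c.
- move=> t _ /=; rewrite lee_fin.
  by apply: le_trans (ler_norm _); exact: c_dominated.
Qed.

Let strategy := {psi : open_loop | feasible psi}.

(** The abstract projection argument is used with the expected cost as objective and the squared
    [L^2] norm and distance of the levels; domination by an integrable function makes all these
    integrals finite. *)
Let close_minimizing_sequence (e : nat -> R) :
  (forall n, 0 < e n) -> (forall n, e n.+1 <= e n) ->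
  exists u : nat -> open_loop, [/\ forall n, feasible (u n),
    forall n psi, feasible psi ->
      (\int[P]_t (c (u n) t)%:E <= \int[P]_t (c psi t)%:E + (e n)%:E)%E &
    forall n, (\int[P]_t (sqdist (u n) (u n.+1) t)%:E <= (8 * e n)%:E)%E].
Proof.
move=> e0 edec.
pose Phi (x : strategy) := \int[P]_t c (sval x) t.
pose q (x : strategy) := \int[P]_t sqdist (sval x) zero t.
pose D (x y : strategy) := \int[P]_t sqdist (sval x) (sval y) t.
pose smid (x y : strategy) : strategy :=
  exist _ (mid (sval x) (sval y)) (feasible_mid _ _ (svalP x) (svalP y)).
have PhiE (x : strategy) : (\int[P]_t (c (sval x) t)%:E = (Phi x)%:E)%E.
  rewrite /Phi /Rintegral fineK//; apply: integrable_fin_num => //.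
  exact: integrable_c (svalP x).
have DE (x y : strategy) : (\int[P]_t (sqdist (sval x) (sval y) t)%:E = (D x y)%:E)%E.
  rewrite /D /Rintegral fineK//; apply: integrable_fin_num => //.
  exact: integrable_sqdist (svalP x) (svalP y).
have cst_int (r : R) : \int[P]_t r = r.
  by rewrite /Rintegral -(expectationE _ _ _ P (cst r)) expectation_cst.
have cst_integrable (r : R) : P.-integrable setT (EFin \o cst r).
  exact: finite_measure_integrable_cst.
have iD (f f' : T -> R) : P.-integrable setT (EFin \o f) ->
    P.-integrable setT (EFin \o f') ->
    P.-integrable setT (EFin \o (fun t => f t + f' t)).
  by move=> fi fi'; exact: (integrableD measurableT fi fi').
have iZ (r : R) (f : T -> R) : P.-integrable setT (EFin \o f) ->
    P.-integrable setT (EFin \o (fun t => r * f t)).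
  by move=> fi; exact: (integrableZl measurableT r fi).
have [||||u [uPhi uD]] := @minimizing_cauchy_sequence R strategy Phi q D smid
  (exist _ zero feasible_zero) (\int[P]_t (- (`|c zero t| + kappa))) diam e _ _ _ _ e0 edec.
- move=> x; apply: le_Rintegral => //.
  + rewrite (_ : EFin \o _ = \- (fun t => (`|c zero t| + kappa)%:E))%E//.
    exact: integrableN.
  + exact: integrable_c (svalP x).
  + by move=> t _; have := c_dominated _ t (svalP x); rewrite ler_norml => /andP[].
- move=> x; apply/andP; split; first exact: Rintegral_ge0.
  rewrite -(cst_int diam); apply: le_Rintegral => //.
  + exact: integrable_sqdist (svalP x) feasible_zero.
  + exact: cst_integrable.
  + by move=> t _; exact: sqdist_le (svalP x) feasible_zero.
- move=> x y; rewrite /Phi -RintegralD//; [|exact: integrable_c (svalP _)..].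
  rewrite mulrC -RintegralZl//; last first.
    by apply: iD; exact: integrable_c (svalP _).
  apply: le_Rintegral => //.
  + exact: integrable_c (svalP (smid x y)).
  + apply: iZ.
    by apply: iD; exact: integrable_c (svalP _).
  + by move=> t _; rewrite mulrC; exact: c_mid.
- move=> x y; have isq (w : strategy) := integrable_sqdist _ _ (svalP w) feasible_zero.
  rewrite /D; under eq_Rintegral do rewrite sqdist_mid.
  have i1 := iD _ _ (isq x) (isq y); have i2 := isq (smid x y).
  rewrite RintegralB//; [|exact: iZ i1|exact: iZ i2].
  rewrite RintegralZl//; rewrite RintegralZl//; rewrite RintegralD//.
exists (fun n => sval (u n)); split.
- by move=> n; exact: svalP.
- move=> n psi fpsi; rewrite PhiE (PhiE (exist _ psi fpsi)) -EFinD lee_fin.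
  exact: uPhi.
- by move=> n; rewrite DE lee_fin.
Qed.

Lemma finite_cost_minimizer :
  exists2 psi, feasible psi & forall psi', feasible psi' ->
    ('E_P[c psi] <= 'E_P[c psi'])%E.
Proof.
(* The [8] cancels the constant in the distance bound, [4 ^+ n] is the weight in [f] below, and
   [2 ^ n.+1] leaves a summable bound on the integrals. *)
pose E n : R := 8 * 4 ^+ n * (2 ^ n.+1)%:R.
have E0 n : 0 < E n by rewrite !mulr_gt0// ?exprn_gt0// ltr0n expn_gt0.
pose e n : R := (E n)^-1.
have e0 n : 0 < e n by rewrite invr_gt0.
have edec n : e n.+1 <= e n.
  rewrite lef_pV2 ?posrE// /E.
  rewrite ler_pM// ?mulr_ge0// ?exprn_ge0//.
    by rewrite ler_pM2l// ler_eXn2l// ltr1n.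
  by rewrite ler_nat leq_exp2l.
have [u [fu umin uD]] := close_minimizing_sequence e e0 edec.
pose f n t := 4 ^+ n * sqdist (u n) (u n.+1) t.
have f_ae : {ae P, forall t, exists B, forall n, f n t <= B}.
  apply: ae_bounded_of_summable.
  - by move=> n; apply: measurable_funM => //; exact: measurable_sqdist.
  - by move=> n t; rewrite mulr_ge0// exprn_ge0.
  - move=> n; under eq_integral do rewrite EFinM.
    rewrite integralZl//; last exact: integrable_sqdist.
    apply: le_trans (lee_wpmul2l _ (uD n)) _; first by rewrite lee_fin exprn_ge0.
    rewrite -EFinM lee_fin /e /E div1r !invfM.
    rewrite le_eqVlt; apply/orP; left; apply/eqP; field.
    by rewrite pnatr_eq0 expn_eq0/= expf_neq0.
have cvg_u t : (exists B, forall n, f n t <= B) ->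
    forall k, (k < N)%N -> forall i, cvgn (fun n => z (u n) k.+1 t i 0).
  (* The weight [4 ^+ n] is the square of [2 ^+ n]: the increment [y] times [2 ^+ n] has square at
     most [B], hence absolute value at most [1 + B]. *)
  move=> [B fB] k kN i; apply: (geometric_increments_cvg _ _ (1 + B)) => n.
  have le1 : (2 ^+ n * (z (u n) k.+1 t i 0 - z (u n.+1) k.+1 t i 0)) ^+ 2 <= B.
    apply: le_trans (fB n); rewrite exprMn -exprM mulnC exprM.
    rewrite (_ : 2 ^+ 2 = 4 :> R); last by rewrite -natrX.
    apply: ler_wpM2l; first exact: exprn_ge0.
    rewrite /sqdist (bigD1 (Ordinal kN))//= (bigD1 i)//= -addrA lerDl.
    rewrite addr_ge0//; [|apply: sumr_ge0 => j _];
      by apply: sumr_ge0 => i' _; exact: sqr_ge0.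
  rewrite distrC exprVn ler_pdivlMr ?exprn_gt0// mulrC.
  rewrite -[X in X * _](@ger0_norm _ (2 ^+ n)) ?exprn_ge0// -normrM.
  move: le1; set y := _ * _ => y2; rewrite ler_norml; apply/andP; split; nra.
have u_box n k X i : 0 <= u n k X i 0 <= b i 0 by have [_] := fu n; apply.
(* The upper limit exists and is measurable on all histories, including those without convergence,
   and equals the limit along almost every demand path. Clipping then changes nothing on those
   paths. *)
pose lim_u k X : 'cV[R]_m := \col_i limn_sup (fun n => u n k X i 0).
pose psi : open_loop := fun k X => clip (lim_u k X).
have fpsi : feasible psi.
  split=> [k|k X]; last exact: clip_box.
  apply: (measurableT_comp measurable_clip); apply: measurable_matrix => i j.
  rewrite (_ : (fun X => _) = fun X => limn_sup (fun n => u n k X i 0)); last first.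
    by apply/funext => X; rewrite mxE.
  apply: (@measurable_fun_limn_sup _ _ _ setT (fun n X => u n k X i 0)).
  - by move=> X _; exists (b i 0) => _ [n _ <-]; have /andP[] := u_box n k X i.
  - by move=> X _; exists 0 => _ [n _ <-]; have /andP[] := u_box n k X i.
  - by move=> n; apply: measurable_matrix_entry; have [+ _] := fu n; exact.
have z_cvg t : (exists B, forall n, f n t <= B) ->
    forall k, (k <= N)%N -> forall i, z (u n) k t i 0 @[n --> \oo] --> z psi k t i 0.
  move=> ft [|k] kN i; first by rewrite /z /=; exact: cvg_cst.
  have cu := cvg_u t ft k kN.
  have limE : lim_u k (demand_upto (xi ^~ t) k)
      = \col_i limn (fun n => z (u n) k.+1 t i 0).
    by apply/colP => i'; rewrite !mxE; exact: cvg_limn_supE.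
  rewrite [X in _ --> X](_ : _ = limn (fun n => z (u n) k.+1 t i 0)); first exact: cu.
  rewrite /z /= /psi limE clip_id ?mxE// => i'; rewrite mxE; apply/andP; split.
    apply: limr_ge => //; apply: nearW => n.
    by have /andP[] := u_box n k (demand_upto (xi ^~ t) k) i'.
  apply: limr_le => //; apply: nearW => n.
  by have /andP[] := u_box n k (demand_upto (xi ^~ t) k) i'.
have c_cvg t : (exists B, forall n, f n t <= B) -> c (u n) t @[n --> \oo] --> c psi t.
  move=> ft.
  apply: (cvg_bigsum _ _ _ (fun (k : 'I_N) n =>
    h (xi k t + (z (u n) k.+1 t - z (u n) k t)))) => k.
  apply: h_cvg => i.
  have entryE (p q r : 'cV[R]_m) : (p + (q - r)) i 0 = p i 0 + (q i 0 - r i 0).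
    by rewrite !mxE.
  rewrite entryE; under eq_fun do rewrite entryE.
  apply: cvgD; first exact: cvg_cst.
  apply: cvgB; first exact: (z_cvg t ft k.+1 (ltn_ord k) i).
  exact: (z_cvg t ft k (ltnW (ltn_ord k)) i).
have [||||_ _ int_cvg] := @dominated_convergence _ _ _ P _ measurableT
  (fun n t => (c (u n) t)%:E) (fun t => (c psi t)%:E) _ _ _ _ integrable_bound.
- by move=> n; exact/measurable_EFinP/measurable_c.
- exact/measurable_EFinP/measurable_c.
- by apply: filterS f_ae => t /c_cvg ct _; apply: cvg_EFin => //; exact: nearW.
- by apply: filterE => t n _; rewrite lee_fin; exact: c_dominated.
exists psi => // psi' fpsi'; rewrite !expectationE.
apply/lee_addgt0Pr => r r0.
rewrite -(cvg_lim _ int_cvg)//.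
apply: lime_le; first by apply/cvg_ex; eexists; exact: int_cvg.
(* The tolerance [e n] is at most [2^-1 ^+ n], so it tends to zero. *)
have [n0 n0r] : exists n0, forall n, (n0 <= n)%N -> e n <= r.
  have : (geometric 1 2^-1 : R^nat) @ \oo --> (0 : R).
    by apply: cvg_geometric; rewrite ger0_norm ?invr_ge0// invf_lt1// ltr1n.
  move=> /cvgrPdist_le /(_ r r0)[n0 _ hn0]; exists n0 => n n0n.
  apply: le_trans (hn0 n n0n); rewrite sub0r normrN /= mul1r exprVn.
  apply: le_trans (ler_norm _).
  rewrite /e lef_pV2 ?posrE ?exprn_gt0// /E natrX exprS.
  have p1 : 1 <= 2 ^+ n :> R by rewrite exprn_ege1// ler1n.
  have p2 : 1 <= 4 ^+ n :> R by rewrite exprn_ege1// ler1n.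
  by nra.
exists n0 => // n /= n0n.
by apply: le_trans (umin n _ fpsi') _; rewrite leeD2l// lee_fin n0r.
Qed.

End finite_cost.

Lemma optimal_policy_exists :
  exists2 pi, adm b pi &
    expected_cost P alpha beta N xi pi = optimal_cost P G alpha beta N xi b.
Proof.
have [psi fpsi psimin] : exists2 psi, feasible psi & forall psi', feasible psi' ->
    ('E_P[c psi] <= 'E_P[c psi'])%E.
  (* If the cost of empty storage is infinite, keeping the storage empty is itself optimal. *)
  have [fin|nfin] := boolP (('E_P[c zero])%E \is a fin_num).
    exact: finite_cost_minimizer.
  by exists zero => // psi' fpsi'; exact: zero_minimal.
have [pi apb piE] := expected_cost_feasible _ fpsi; exists pi => //.
apply/eqP; rewrite eq_le; apply/andP; split; last exact: optimal_cost_le.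
apply: le_optimal_cost => pi' apb'.
have [psi' fpsi'] := expected_cost_ge _ apb'; apply: le_trans.
by rewrite piE; exact: psimin.
Qed.

End existence.

(** The lower bound on [gen_cost] over the polytope concerns attainment: equal angles at all nodes
    produce no line flow but inject a multiple of the shunt susceptances, so the polytope can be
    unbounded and the cost on it unbounded below. *)
Theorem theorem1 (R : realType) (d : measure_display) (T : measurableType d)
    (P : probability T R)
    (m l : nat) (G : network R m l)
    (alpha beta : 'cV[R]_m)
    (cost_coeffs : forall i, 0 <= beta i 0 <= alpha i 0)
    (N : nat) (Xi : set 'cV[R]_m) (xi : nat -> T -> 'cV[R]_m)
    (xi_measurable : forall k, (k < N)%N -> measurable_fun [set: T] (xi k))
    (xi_in_Xi : forall k t, (k < N)%N -> Xi (xi k t)) :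
  ((exists C : R, forall x, injection_polytope G x ->
      C <= gen_cost alpha beta x) ->
    forall b : 'cV[R]_m, (forall i, 0 <= b i 0) ->
      exists2 pi : policy R m, admissible P G N xi b pi &
        expected_cost P alpha beta N xi pi
          = optimal_cost P G alpha beta N xi b) /\
  (forall (b b' : 'cV[R]_m) (t : R),
      (forall i, 0 <= b i 0) -> (forall i, 0 <= b' i 0) -> 0 <= t <= 1 ->
      (optimal_cost P G alpha beta N xi (t *: b + (1 - t) *: b')
         <= t%:E * optimal_cost P G alpha beta N xi b
            + (1 - t)%:E * optimal_cost P G alpha beta N xi b')%E) /\
  (forall b b' : 'cV[R]_m,
      (forall i, 0 <= b i 0) -> (forall i, b i 0 <= b' i 0) ->
      (optimal_cost P G alpha beta N xi b'
         <= optimal_cost P G alpha beta N xi b)%E).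
Proof.
split=> [bounded b b0|].
  have [h [s [mh ms hs h_min]]] :=
    dispatch_selection R m alpha beta cost_coeffs l G bounded.
  exact: optimal_policy_exists b0 h s mh ms hs h_min.
split=> [b b' t b0 b'0 t01|b b' b0 bb'].
  exact: optimal_cost_convex.
exact: optimal_cost_antitone.
Qed.
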